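(* Let $N_1,N_2\ge 0$ and let $(u(r),v(r))$ be an entire radial solution, with $u\not\equiv v$, of the system $$\begin{cases}\Delta u=-2e^u+e^v+4e^{2u}-2e^{2v}-e^{u+v}+4\pi N_1\delta_0\\ \Delta v=e^u-2e^v-2e^{2u}+4e^{2v}-e^{u+v}+4\pi N_2\delta_0\end{cases}\quad\text{in }\mathbb{R}^2.$$ Then $u$ and $v$ intersect only finitely many times, i.e. the set $\{r\in(0,\infty): u(r)=v(r)\}$ is finite.
   Context: Here $\delta_0$ is the Dirac measure at the origin of $\mathbb{R}^2$ and $r=|x|$. An entire radial solution is a pair of functions $u(r),v(r)$ defined for all $r\in(0,\infty)$, satisfying the system away from the origin, i.e. $u_{rr}+\frac1r u_r=-2e^u+e^v+4e^{2u}-2e^{2v}-e^{u+v}$ and $v_{rr}+\frac1r v_r=e^u-2e^v-2e^{2u}+4e^{2v}-e^{u+v}$ on $(0,\infty)$, and satisfying $u(r)=2N_1\log r+O(1)$, $v(r)=2N_2\log r+O(1)$ as $r\to0^+$ (with Dirac masses $4\pi N_1$, $4\pi N_2$ at the origin, so that $ru_r\to 2N_1$ and $rv_r\to 2N_2$ as $r\to 0^+$). *)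

(* Defs.v *)
From Stdlib Require Import Reals.
From Coquelicot Require Import Coquelicot.
Open Scope R_scope.

(* Functions on (0,oo) are represented by total functions R -> R, of which only
   the values on (0,oo) are ever constrained. *)

Definition radial_laplacian (w : R -> R) (r : R) : R :=
  Derive_n w 2 r + / r * Derive w r.

(* [Derive] is total, so twice differentiability has to be required separately. *)
Definition twice_derivable_pos (w : R -> R) : Prop :=
  forall r : R, 0 < r -> ex_derive w r /\ ex_derive (Derive w) r.

(* The part of "Delta w = f + 4 pi N delta_0" concentrated at the origin: the
   logarithmic singularity, and the flux 2 pi r w'(r) -> 4 pi N through small
   circles, i.e. r w'(r) -> 2 N. *)
Definition dirac_mass_at_origin (N : R) (w : R -> R) : Prop :=
  (exists C : R, at_right 0 (fun r => Rabs (w r - 2 * N * ln r) <= C)) /\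
  filterlim (fun r => r * Derive w r) (at_right 0) (locally (2 * N)).

Definition entire_radial_solution (N1 N2 : R) (u v : R -> R) : Prop :=
  twice_derivable_pos u /\
  twice_derivable_pos v /\
  (forall r : R, 0 < r ->
     radial_laplacian u r =
       - 2 * exp (u r) + exp (v r) + 4 * exp (2 * u r) - 2 * exp (2 * v r)
       - exp (u r + v r)) /\
  (forall r : R, 0 < r ->
     radial_laplacian v r =
       exp (u r) - 2 * exp (v r) - 2 * exp (2 * u r) + 4 * exp (2 * v r)
       - exp (u r + v r)) /\
  dirac_mass_at_origin N1 u /\
  dirac_mass_at_origin N2 v.

(* Main.v *)
Require Import Defs.
From Stdlib Require Import Reals Lra Psatz Classical Finite_sets Finite_sets_facts.
From Coquelicot Require Import Coquelicot.
Open Scope R_scope.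

(* Put s = (u+v)/2, w = u-v, S = r s', B = r w', p = e^u + e^v.  Then
   (r w')' = 3 r (2p - 1)(e^u - e^v), so zeros of w are simple by unique
   continuation, they do not accumulate at 0 (w behaves like 2(N1-N2) log r there,
   or is small against itself when N1 = N2), and |w| can only peak where p <= 1/2.

   Suppose zeros accumulate at infinity.  Where p <= 1/2, S decreases.  If S <= 0 at
   a peak of |w|, then F = w'^2/12 + p - p^2 decreases from there on, which keeps
   p < 1/2 and S < 0 forever; a Pohozaev-type bound on S, and then S < -2 eventually,
   give a decay of r^2 p which leaves no room for further oscillation of w.

   So S > 0 at every late peak, and before such a peak q there is a last point e < q
   with p(e) = 1/2 (otherwise S could not stay positive).  The energy
   E = s'^2 + w'^2/12 + p - p^2 + 3 e^(u+v) is nonincreasing, at least 1/4 at each e,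
   and E - F decreases on [e, q].  Since p' <= 0 at e forces |w'| >= 2 s', this makes E
   drop by s'(e)^2/3 at least.  Finally s'(e) is bounded below: on [e, q] one has
   |w'| <= 6 s', so if s' were small at the zero of w in between, E >= 1/4 would keep
   e^(u+v), hence the decrease of S over the rest of the interval, away from 0.
   Thus E drops infinitely often by a fixed amount, a contradiction. *)

(** * Calculus *)

Lemma le_of_derive_nonneg (f f' : R -> R) (a b : R) :
  a <= b ->
  (forall r, a <= r <= b -> is_derive f r (f' r)) ->
  (forall r, a < r < b -> 0 <= f' r) -> f a <= f b.
Proof.
intros Hab Hd Hp.
destruct (Req_dec a b) as [->|Hne]; [lra|].
destruct (MVT_cor2 f f' a b) as [c [Hc1 Hc2]]; [lra| |].
- intros c Hc; apply is_derive_Reals, Hd, Hc.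
- specialize (Hp c Hc2); nra.
Qed.

Lemma ge_of_derive_nonpos (f f' : R -> R) (a b : R) :
  a <= b ->
  (forall r, a <= r <= b -> is_derive f r (f' r)) ->
  (forall r, a < r < b -> f' r <= 0) -> f b <= f a.
Proof.
intros Hab Hd Hp.
destruct (Req_dec a b) as [->|Hne]; [lra|].
destruct (MVT_cor2 f f' a b) as [c [Hc1 Hc2]]; [lra| |].
- intros c Hc; apply is_derive_Reals, Hd, Hc.
- specialize (Hp c Hc2); nra.
Qed.

Lemma gt_of_derive_neg (f f' : R -> R) (a b : R) :
  a < b ->
  (forall r, a <= r <= b -> is_derive f r (f' r)) ->
  (forall r, a < r < b -> f' r < 0) -> f b < f a.
Proof.
intros Hab Hd Hp.
destruct (MVT_cor2 f f' a b) as [c [Hc1 Hc2]]; [lra| |].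
- intros c Hc; apply is_derive_Reals, Hd, Hc.
- specialize (Hp c Hc2); nra.
Qed.

Lemma is_derive_neg_strict (f : R -> R) (a l : R) :
  is_derive f a l -> l < 0 ->
  exists delta : R, 0 < delta /\
    (forall r, a < r < a + delta -> f r < f a) /\
    (forall r, a - delta < r < a -> f a < f r).
Proof.
intros Hd Hl.
apply is_derive_Reals in Hd.
destruct (Hd (- l)) as [delta Hdelta]; [lra|].
exists delta; split; [apply cond_pos|].
assert (key : forall h, h <> 0 -> Rabs h < delta -> (f (a + h) - f a) / h < 0).
{ intros h Hh Hh'.
  specialize (Hdelta h Hh Hh'); apply Rabs_def2 in Hdelta; lra. }
split; intros r Hr.
- specialize (key (r - a)).
  replace (a + (r - a)) with r in key by ring.
  assert (Hq : (f r - f a) / (r - a) < 0).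
  { apply key; [lra|rewrite Rabs_right; lra]. }
  replace (f r) with (f a + (f r - f a) / (r - a) * (r - a)) by (field; lra).
  nra.
- specialize (key (r - a)).
  replace (a + (r - a)) with r in key by ring.
  assert (Hq : (f r - f a) / (r - a) < 0).
  { apply key; [lra|rewrite Rabs_left; lra]. }
  replace (f r) with (f a + (f r - f a) / (r - a) * (r - a)) by (field; lra).
  nra.
Qed.

Lemma is_derive_pos_strict (f : R -> R) (a l : R) :
  is_derive f a l -> 0 < l ->
  exists delta : R, 0 < delta /\
    (forall r, a < r < a + delta -> f a < f r) /\
    (forall r, a - delta < r < a -> f r < f a).
Proof.
intros Hd Hl.
destruct (is_derive_neg_strict (fun r => - f r) a (- l)) as [delta [H0 [H1 H2]]].
- exact (is_derive_opp f a l Hd).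
- lra.
- exists delta; split; [exact H0|split]; intros r Hr.
  + specialize (H1 r Hr); lra.
  + specialize (H2 r Hr); lra.
Qed.

Lemma continuous_gt (f : R -> R) (a c : R) :
  continuous f a -> c < f a ->
  exists delta : R, 0 < delta /\ forall r, Rabs (r - a) < delta -> c < f r.
Proof.
intros Hc Hlt.
destruct (Hc (fun y => c < y) (open_gt c (f a) Hlt)) as [delta Hdelta].
exists delta; split; [apply cond_pos|].
intros r Hr; apply Hdelta, Hr.
Qed.

Lemma continuous_lt (f : R -> R) (a c : R) :
  continuous f a -> f a < c ->
  exists delta : R, 0 < delta /\ forall r, Rabs (r - a) < delta -> f r < c.
Proof.
intros Hc Hlt.
destruct (Hc (fun y => y < c) (open_lt c (f a) Hlt)) as [delta Hdelta].
exists delta; split; [apply cond_pos|].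
intros r Hr; apply Hdelta, Hr.
Qed.

(** The point [e] is the supremum of the set where [f] exceeds [c]; continuity excludes both
    [f e > c] and [f e < c]. *)
Lemma last_crossing (f : R -> R) (a b c : R) :
  a <= b -> (forall r, a <= r <= b -> continuous f r) ->
  c < f a -> f b <= c ->
  exists e, a < e <= b /\ f e = c /\ forall r, e <= r <= b -> f r <= c.
Proof.
intros Hab Hc Ha Hb.
destruct (completeness (fun r => a <= r <= b /\ c < f r)) as [e [He1 He2]].
{ exists b; intros r [Hr _]; lra. }
{ exists a; split; [lra|exact Ha]. }
assert (Hae : a <= e) by (apply He1; split; [lra|exact Ha]).
assert (Heb : e <= b) by (apply He2; intros r [Hr _]; lra).
assert (Hright : forall r, e < r <= b -> f r <= c).
{ intros r Hr; apply Rnot_lt_le; intros Hlt.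
  assert (r <= e) by (apply He1; split; [lra|exact Hlt]); lra. }
assert (Hle : f e <= c).
{ apply Rnot_lt_le; intros Hlt.
  destruct (continuous_gt f e c (Hc e (conj Hae Heb)) Hlt) as [d [Hd0 Hd]].
  destruct (Req_dec e b) as [->|Hne]; [lra|].
  set (r := Rmin b (e + d / 2)).
  assert (Hr : e < r <= b /\ r <= e + d / 2).
  { unfold r; split; [split|]; [apply Rmin_glb_lt; lra|apply Rmin_l|apply Rmin_r]. }
  assert (c < f r) by (apply Hd; rewrite Rabs_right; lra).
  assert (f r <= c) by (apply Hright; lra); lra. }
assert (Hge : c <= f e).
{ apply Rnot_lt_le; intros Hlt.
  destruct (continuous_lt f e c (Hc e (conj Hae Heb)) Hlt) as [d [Hd0 Hd]].
  assert (Hub : is_upper_bound (fun r => a <= r <= b /\ c < f r) (e - d / 2)).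
  { intros r [Hr1 Hr2]; apply Rnot_lt_le; intros Hlt'.
    assert (r <= e) by (apply He1; split; [exact Hr1|exact Hr2]).
    assert (f r < c) by (apply Hd; apply Rabs_def1; lra); lra. }
  apply He2 in Hub; lra. }
exists e; split; [|split].
- split; [|lra]. destruct (Req_dec a e) as [E|]; [rewrite <- E in Hle; lra|lra].
- lra.
- intros r Hr; destruct (Req_dec r e) as [->|]; [exact Hle|apply Hright; lra].
Qed.

Lemma first_crossing (f : R -> R) (a b c : R) :
  a <= b -> (forall r, a <= r <= b -> continuous f r) ->
  f a <= c -> c < f b ->
  exists e, a <= e < b /\ f e = c /\ forall r, a <= r <= e -> f r <= c.
Proof.
intros Hab Hc Ha Hb.
(* The reflection [r -> - r] turns a first crossing into a last one. *)
destruct (last_crossing (fun r => f (- r)) (- b) (- a) c) as [e [He [Hfe Hr]]].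
- lra.
- intros r Hr; apply continuous_comp.
  + apply (continuous_opp (fun r : R => r)), continuous_id.
  + apply Hc; simpl; unfold opp; simpl; lra.
- rewrite Ropp_involutive; exact Hb.
- rewrite Ropp_involutive; exact Ha.
- exists (- e); split; [lra|split; [exact Hfe|]].
  intros r Hr'; rewrite <- (Ropp_involutive r); apply Hr; lra.
Qed.

Lemma last_nonpos (f : R -> R) (a b : R) :
  a <= b -> (forall r, a <= r <= b -> continuous f r) -> f a <= 0 -> 0 < f b ->
  exists z, a <= z < b /\ f z = 0 /\ forall r, z < r <= b -> 0 < f r.
Proof.
intros Hab Hc Ha Hb.
destruct (completeness (fun r => a <= r <= b /\ f r <= 0)) as [z [Hz1 Hz2]].
{ exists b; intros r [Hr _]; lra. }
{ exists a; split; [lra|exact Ha]. }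
assert (Haz : a <= z) by (apply Hz1; split; [lra|exact Ha]).
assert (Hzb : z <= b) by (apply Hz2; intros r [Hr _]; lra).
assert (Hright : forall r, z < r <= b -> 0 < f r).
{ intros r Hr; apply Rnot_le_lt; intros Hle.
  assert (r <= z) by (apply Hz1; split; [lra|exact Hle]); lra. }
assert (Hle : f z <= 0).
{ apply Rnot_lt_le; intros Hlt.
  destruct (continuous_gt f z 0 (Hc z (conj Haz Hzb)) Hlt) as [d [Hd0 Hd]].
  assert (Hub : is_upper_bound (fun r => a <= r <= b /\ f r <= 0) (z - d / 2)).
  { intros r [Hr1 Hr2]; apply Rnot_lt_le; intros Hlt'.
    assert (r <= z) by (apply Hz1; split; [exact Hr1|exact Hr2]).
    assert (0 < f r) by (apply Hd; apply Rabs_def1; lra); lra. }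
  apply Hz2 in Hub; lra. }
assert (Hne : z < b).
{ destruct (Req_dec z b) as [->|]; lra. }
assert (Hge : 0 <= f z).
{ apply Rnot_lt_le; intros Hlt.
  destruct (continuous_lt f z 0 (Hc z (conj Haz Hzb)) Hlt) as [d [Hd0 Hd]].
  set (r := Rmin b (z + d / 2)).
  assert (Hr : z < r <= b /\ r <= z + d / 2).
  { unfold r; split; [split|]; [apply Rmin_glb_lt; lra|apply Rmin_l|apply Rmin_r]. }
  assert (f r < 0) by (apply Hd; rewrite Rabs_right; lra).
  assert (0 < f r) by (apply Hright; lra); lra. }
exists z; split; [lra|split; [lra|exact Hright]].
Qed.

(** Let [m] be the supremum of the [c] for which [[a, c]] contains finitely many points of [P]. The
    neighbourhood isolating [m] adds at most one point, so finiteness extends past [m], which is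
    impossible unless [b] is already reached. *)
Lemma finite_of_isolated (P : R -> Prop) (a b : R) :
  (forall x, a <= x <= b -> exists d, 0 < d /\ forall y, Rabs (y - x) < d -> P y -> y = x) ->
  Finite_sets.Finite R (fun r => a <= r <= b /\ P r).
Proof.
intros Hiso.
destruct (Rlt_le_dec b a) as [Hlt|Hab].
{ apply Finite_downward_closed with (Empty_set R); [apply Empty_is_finite|].
  intros x [Hx _]; lra. }
set (Fin := fun c => a <= c <= b /\ Finite_sets.Finite R (fun r => a <= r <= c /\ P r)).
assert (Hsub : forall c x d : R,
  (forall y, Rabs (y - x) < d -> P y -> y = x) ->
  Finite_sets.Finite R (fun r => a <= r <= c /\ P r) -> x - d < c ->
  forall c', c' < x + d -> Finite_sets.Finite R (fun r => a <= r <= c' /\ P r)).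
{ intros c x d Hd Hc Hxc c' Hc'.
  apply Finite_downward_closed with
    (Union R (fun r => a <= r <= c /\ P r) (Singleton R x)).
  - apply Union_preserves_Finite; [exact Hc|apply Singleton_is_finite].
  - intros y [Hy HPy].
    destruct (Rle_lt_dec y c) as [Hle|Hgt].
    + left; split; [lra|exact HPy].
    + right; rewrite (Hd y); [constructor|apply Rabs_def1; lra|exact HPy]. }
assert (Ha : Fin a).
{ split; [lra|].
  apply Finite_downward_closed with (Singleton R a); [apply Singleton_is_finite|].
  intros x [Hx _]; replace x with a by lra; constructor. }
destruct (completeness Fin) as [m [Hm1 Hm2]].
{ exists b; intros c [Hc _]; lra. }
{ exists a; exact Ha. }
assert (Ham : a <= m) by (apply Hm1, Ha).
assert (Hmb : m <= b) by (apply Hm2; intros c [Hc _]; lra).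
destruct (Hiso m (conj Ham Hmb)) as [d [Hd0 Hd]].
assert (Hc : exists c, Fin c /\ m - d < c).
{ apply NNPP; intros Hno.
  assert (m <= m - d); [|lra].
  apply Hm2; intros c Hc; apply Rnot_lt_le; intros Hlt; apply Hno; exists c; split; assumption. }
destruct Hc as [c [[_ Hc] Hmc]].
assert (Hnext := Hsub c m d Hd Hc Hmc).
destruct (Rlt_le_dec b (m + d)) as [Hlt|Hle]; [apply Hnext, Hlt|].
assert (m + d / 2 <= m); [|lra].
apply Hm1; split; [lra|apply Hnext; lra].
Qed.

(* [auto_derive] leaves the derivative of an unknown function [f] as the
   eta-expanded [Derive (fun x => f x)], which [is_derive_unique] does not match. *)
Ltac rewrite_derive D :=
  match type of D with
  | is_derive ?f ?r ?l =>
      replace (Derive (fun x : R => f x) r) with l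
        by (symmetry; apply is_derive_unique; exact D)
  end.

(** Gronwall in both directions: [h e^(-C r)] is nonincreasing and [h e^(C r)] is nondecreasing, so
    a zero of [h] spreads to the right by the first and to the left by the second. *)
Lemma nonneg_zero_of_derive_bound (h h' : R -> R) (C a b : R) :
  a <= b ->
  (forall r, a <= r <= b -> is_derive h r (h' r)) ->
  (forall r, a <= r <= b -> 0 <= h r) ->
  (forall r, a <= r <= b -> Rabs (h' r) <= C * h r) ->
  (h a = 0 <-> h b = 0).
Proof.
intros Hab Hd Hp Hb.
assert (Habs : forall r, a <= r <= b -> - (C * h r) <= h' r <= C * h r).
{ intros r Hr; apply Rabs_le_between, Hb, Hr. }
assert (H1 : h b * exp (- C * b) <= h a * exp (- C * a)).
{ apply (ge_of_derive_nonpos (fun r => h r * exp (- C * r))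
          (fun r => (h' r - C * h r) * exp (- C * r))); [exact Hab| |].
  - intros r Hr.
    assert (D := Hd r Hr).
    auto_derive; [exists (h' r); exact D|].
    rewrite_derive D; ring.
  - intros r Hr; assert (He := exp_pos (- C * r)).
    assert (h' r <= C * h r) by (apply Habs; lra); nra. }
assert (H2 : h a * exp (C * a) <= h b * exp (C * b)).
{ apply (le_of_derive_nonneg (fun r => h r * exp (C * r))
          (fun r => (h' r + C * h r) * exp (C * r))); [exact Hab| |].
  - intros r Hr.
    assert (D := Hd r Hr).
    auto_derive; [exists (h' r); exact D|].
    rewrite_derive D; ring.
  - intros r Hr; assert (He := exp_pos (C * r)).
    assert (- (C * h r) <= h' r) by (apply Habs; lra); nra. }
assert (Pa := Hp a ltac:(lra)); assert (Pb := Hp b ltac:(lra)).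
assert (E1 := exp_pos (- C * b)); assert (E2 := exp_pos (C * a)).
split; intros H0; rewrite H0 in *; nra.
Qed.

(** * The system for half-sum and difference *)

(* At s = (u+v)/2 and w = u-v these are e^u + e^v, e^u - e^v and -2 times the
   Laplacian of s; S and B below stand for r s' and r w'. *)
Definition mass (s w : R) : R := exp (s + w / 2) + exp (s - w / 2).
Definition gap (s w : R) : R := exp (s + w / 2) - exp (s - w / 2).
Definition force (s w : R) : R := mass s w * (1 - 2 * mass s w) + 6 * exp (2 * s).

(** First-order form of the radial system: the Laplacian of [f] is [(r f')' / r], so taking [r s']
    and [r w'] as unknowns avoids second derivatives. *)
Definition flow (s w S B : R -> R) : Prop :=
  forall r, 0 < r ->
    is_derive s r (S r / r) /\ is_derive w r (B r / r) /\
    is_derive S r (- (r * force (s r) (w r) / 2)) /\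
    is_derive B r (- (3 * r * gap (s r) (w r) * (1 - 2 * mass (s r) (w r)))).

(** The energy [E] of the outline, with [s' = S / r] and [w' = B / r]. *)
Definition energy (s w S B : R -> R) (r : R) : R :=
  (S r ^ 2 + B r ^ 2 / 12) / r ^ 2 +
  (mass (s r) (w r) - mass (s r) (w r) ^ 2 + 3 * exp (2 * s r)).

(** The quantity [F] of the outline: [E] without its terms in [s'] and [e^(2 s)]. *)
Definition gap_energy (s w B : R -> R) (r : R) : R :=
  B r ^ 2 / 12 / r ^ 2 + (mass (s r) (w r) - mass (s r) (w r) ^ 2).

Lemma mass_pos (s w : R) : 0 < mass s w.
Proof.
unfold mass; assert (H1 := exp_pos (s + w / 2)); assert (H2 := exp_pos (s - w / 2)); lra.
Qed.

Lemma exp_mul_split (s w : R) : exp (s + w / 2) * exp (s - w / 2) = exp (2 * s).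
Proof. rewrite <- exp_plus; f_equal; field. Qed.

Lemma mass_sqr (s w : R) : mass s w ^ 2 = gap s w ^ 2 + 4 * exp (2 * s).
Proof. rewrite <- (exp_mul_split s w); unfold mass, gap; ring. Qed.

Lemma gap_le_mass (s w : R) : - mass s w < gap s w < mass s w.
Proof.
unfold mass, gap; assert (H1 := exp_pos (s + w / 2)); assert (H2 := exp_pos (s - w / 2)); lra.
Qed.

Lemma mass_opp (s w : R) : mass s (- w) = mass s w.
Proof.
unfold mass.
replace (s + - w / 2) with (s - w / 2) by field.
replace (s - - w / 2) with (s + w / 2) by field; ring.
Qed.

Lemma gap_opp (s w : R) : gap s (- w) = - gap s w.
Proof.
unfold gap.
replace (s + - w / 2) with (s - w / 2) by field.
replace (s - - w / 2) with (s + w / 2) by field; ring.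
Qed.

Lemma force_opp (s w : R) : force s (- w) = force s w.
Proof. unfold force; rewrite mass_opp; reflexivity. Qed.

Lemma mass_0 (s : R) : mass s 0 = 2 * exp s.
Proof.
unfold mass; replace (s + 0 / 2) with s by field; replace (s - 0 / 2) with s by field; ring.
Qed.

Lemma gap_0 (s : R) : gap s 0 = 0.
Proof.
unfold gap; replace (s + 0 / 2) with s by field; replace (s - 0 / 2) with s by field; ring.
Qed.

Lemma gap_pos (s w : R) : 0 < w -> 0 < gap s w.
Proof.
intros Hw; unfold gap.
assert (exp (s - w / 2) < exp (s + w / 2)) by (apply exp_increasing; lra); lra.
Qed.

(** Since [gap = e^(s + w/2) (1 - e^(-w))], this comes down to [1 - e^(-w) <= w]. *)
Lemma gap_le_mul (s w : R) : 0 <= w -> gap s w <= mass s w * w.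
Proof.
intros Hw.
assert (H1 := exp_pos (s + w / 2)); assert (H2 := exp_pos (s - w / 2)).
assert (H3 : exp (s - w / 2) = exp (s + w / 2) * exp (- w)).
{ rewrite <- exp_plus; f_equal; field. }
assert (H4 : 1 + - w <= exp (- w)).
{ destruct (Req_dec w 0) as [->|H].
  - rewrite Ropp_0, exp_0; lra.
  - left; apply exp_ineq1; lra. }
unfold gap, mass; nra.
Qed.

Lemma abs_gap_le (s w : R) : Rabs (gap s w) <= mass s w * Rabs w.
Proof.
destruct (Rle_lt_dec 0 w) as [H|H].
- rewrite (Rabs_right w) by lra.
  rewrite Rabs_right; [apply gap_le_mul, H|].
  destruct (Req_dec w 0) as [->|]; [rewrite gap_0; lra|].
  left; apply gap_pos; lra.
- rewrite (Rabs_left w) by lra.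
  assert (H1 := gap_pos s (- w)); assert (H2 := gap_le_mul s (- w)).
  rewrite gap_opp in H1, H2; rewrite mass_opp in H2.
  rewrite Rabs_left; lra.
Qed.

Lemma potential_le (s w : R) : 3 * exp (2 * s) <= 3 / 4 * mass s w ^ 2.
Proof. assert (H := mass_sqr s w); nra. Qed.

Lemma exp_le_mass (s w : R) : 2 * exp s <= mass s w.
Proof.
assert (H := mass_sqr s w).
replace (2 * s) with (s + s) in H by ring; rewrite exp_plus in H.
assert (H1 := exp_pos s); assert (H2 := mass_pos s w); nra.
Qed.

Lemma force_pos (s w : R) : mass s w <= 1 / 2 -> 0 < force s w.
Proof.
intros H; unfold force.
assert (H1 := mass_pos s w); assert (H2 := exp_pos (2 * s)); nra.
Qed.

(** The symmetry exchanging [u] and [v]; it reduces negative arches of [w] to positive ones. *)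
Lemma flow_opp (s w S B : R -> R) :
  flow s w S B -> flow s (fun r => - w r) S (fun r => - B r).
Proof.
intros H r Hr; destruct (H r Hr) as [H1 [H2 [H3 H4]]].
rewrite mass_opp, gap_opp, force_opp.
split; [exact H1|split; [|split; [exact H3|]]].
- replace (- B r / r) with (- (B r / r)) by (unfold Rdiv; ring).
  exact (is_derive_opp w r _ H2).
- match goal with |- is_derive _ _ ?l =>
    replace l with (- - (3 * r * gap (s r) (w r) * (1 - 2 * mass (s r) (w r)))) by ring end.
  exact (is_derive_opp B r _ H4).
Qed.

Lemma energy_opp (s w S B : R -> R) (r : R) :
  energy s (fun x => - w x) S (fun x => - B x) r = energy s w S B r.
Proof. unfold energy; rewrite mass_opp; f_equal; unfold Rdiv; ring. Qed.

(** Differentiates an expression in [s], [w], [S], [B] at [r] and substitutes the four derivatives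
    given by the flow [H]. *)
Ltac flow_derive H r :=
  let H1 := fresh in let H2 := fresh in let H3 := fresh in let H4 := fresh in
  destruct (H r ltac:(lra)) as [H1 [H2 [H3 H4]]];
  auto_derive;
  [ repeat split; try (eexists; first [exact H1 | exact H2 | exact H3 | exact H4]); try nra
  | try rewrite_derive H1; try rewrite_derive H2; try rewrite_derive H3; try rewrite_derive H4 ].

Lemma flow_derive_mass (s w S B : R -> R) (r : R) :
  flow s w S B -> 0 < r ->
  is_derive (fun r => mass (s r) (w r)) r
    ((mass (s r) (w r) * S r + gap (s r) (w r) * B r / 2) / r).
Proof.
intros H Hr; unfold mass, gap; flow_derive H r.
unfold Rminus, Rdiv; field; lra.
Qed.

(** [mass - mass^2 + 3 e^(2 s)] acts as a potential for both equations, so its work cancels and only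
    the friction from the [1/r] term of the Laplacian remains. *)
Lemma flow_derive_energy (s w S B : R -> R) (r : R) :
  flow s w S B -> 0 < r ->
  is_derive (energy s w S B) r (- (2 * (S r ^ 2 + B r ^ 2 / 12) / r ^ 3)).
Proof.
intros H Hr.
(* Written through the two exponentials alone, the claim becomes a rational identity that [field]
   decides. *)
apply is_derive_ext with (fun r => (S r ^ 2 + B r ^ 2 / 12) / r ^ 2 +
  (exp (s r + w r / 2) + exp (s r - w r / 2)
   - (exp (s r + w r / 2) + exp (s r - w r / 2)) ^ 2
   + 3 * (exp (s r + w r / 2) * exp (s r - w r / 2)))).
{ intros t; rewrite exp_mul_split; reflexivity. }
flow_derive H r.
unfold force, mass, gap; rewrite <- (exp_mul_split (s r) (w r)).
unfold Rminus, Rdiv; field; lra.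
Qed.

(** Without the [s] terms the work of [s'] on [mass] no longer cancels; what survives follows the
    sign of [S] where [mass <= 1/2]. *)
Lemma flow_derive_gap_energy (s w S B : R -> R) (r : R) :
  flow s w S B -> 0 < r ->
  is_derive (gap_energy s w B) r
    ((1 - 2 * mass (s r) (w r)) * mass (s r) (w r) * S r / r - B r ^ 2 / 6 / r ^ 3).
Proof.
intros H Hr; unfold gap_energy, mass.
flow_derive H r.
unfold force, mass, gap.
unfold Rminus, Rdiv; field; lra.
Qed.

Lemma flow_continuous_mass (s w S B : R -> R) (r : R) :
  flow s w S B -> 0 < r -> continuous (fun r => mass (s r) (w r)) r.
Proof.
intros H Hr; apply (ex_derive_continuous (fun r => mass (s r) (w r))).
eexists; exact (flow_derive_mass s w S B r H Hr).
Qed.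

(** * Monotone quantities along the flow *)

Lemma flow_S_decreasing (s w S B : R -> R) (a b : R) :
  flow s w S B -> 0 < a < b ->
  (forall r, a <= r <= b -> mass (s r) (w r) <= 1 / 2) -> S b < S a.
Proof.
intros H Hab Hm.
apply (gt_of_derive_neg S (fun r => - (r * force (s r) (w r) / 2))); [lra| |].
- intros r Hr; apply H; lra.
- intros r Hr.
  assert (Hf : 0 < force (s r) (w r)) by (apply force_pos, Hm; lra); nra.
Qed.

(** The derivative of [B + 6 S] is [-3 r ((gap + mass) (1 - 2 mass) + 6 e^(2 s))]. Together with the
    mirror image [flow_B_sub_S_ge], this bounds [|B|] by the drop of [6 S] up to a later zero of
    [B]. *)
Lemma flow_B_add_S_le (s w S B : R -> R) (a b : R) :
  flow s w S B -> 0 < a <= b ->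
  (forall r, a <= r <= b -> mass (s r) (w r) <= 1 / 2) ->
  B b + 6 * S b <= B a + 6 * S a.
Proof.
intros H Hab Hm.
apply (ge_of_derive_nonpos (fun r => B r + 6 * S r)
  (fun r => - (3 * r * gap (s r) (w r) * (1 - 2 * mass (s r) (w r)))
            + 6 * - (r * force (s r) (w r) / 2))); [lra| |].
- intros r Hr; flow_derive H r; ring.
- intros r Hr; unfold force.
  assert (H1 := gap_le_mass (s r) (w r)).
  assert (H2 : mass (s r) (w r) <= 1 / 2) by (apply Hm; lra).
  assert (H3 := exp_pos (2 * s r)).
  assert (0 <= (gap (s r) (w r) + mass (s r) (w r)) * (1 - 2 * mass (s r) (w r)))
    by (apply Rmult_le_pos; lra).
  nra.
Qed.

Lemma flow_B_sub_S_ge (s w S B : R -> R) (a b : R) :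
  flow s w S B -> 0 < a <= b ->
  (forall r, a <= r <= b -> mass (s r) (w r) <= 1 / 2) ->
  B a - 6 * S a <= B b - 6 * S b.
Proof.
intros H Hab Hm.
assert (H1 := flow_B_add_S_le _ _ _ _ a b (flow_opp _ _ _ _ H) Hab).
simpl in H1; enough (- B b + 6 * S b <= - B a + 6 * S a) by lra.
apply H1; intros r Hr; rewrite mass_opp; apply Hm, Hr.
Qed.

Lemma flow_energy_nonincreasing (s w S B : R -> R) (a b : R) :
  flow s w S B -> 0 < a <= b -> energy s w S B b <= energy s w S B a.
Proof.
intros H Hab.
apply (ge_of_derive_nonpos (energy s w S B)
  (fun r => - (2 * (S r ^ 2 + B r ^ 2 / 12) / r ^ 3))); [lra| |].
- intros r Hr; apply flow_derive_energy; [exact H|lra].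
- intros r Hr.
  assert (0 <= 2 * (S r ^ 2 + B r ^ 2 / 12) / r ^ 3); [|lra].
  apply Rdiv_le_0_compat; [nra|apply pow_lt; lra].
Qed.

Lemma flow_gap_energy_nonincreasing (s w S B : R -> R) (a b : R) :
  flow s w S B -> 0 < a <= b ->
  (forall r, a <= r <= b -> mass (s r) (w r) <= 1 / 2 /\ S r <= 0) ->
  gap_energy s w B b <= gap_energy s w B a.
Proof.
intros H Hab Hm.
apply (ge_of_derive_nonpos _
  (fun r => (1 - 2 * mass (s r) (w r)) * mass (s r) (w r) * S r / r
            - B r ^ 2 / 6 / r ^ 3)); [lra| |].
- intros r Hr; apply (flow_derive_gap_energy s w S B); [exact H|lra].
- intros r Hr; destruct (Hm r) as [Hm1 Hm2]; [lra|].
  assert (Hm3 := mass_pos (s r) (w r)).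
  assert (0 <= B r ^ 2 / 6 / r ^ 3).
  { apply Rdiv_le_0_compat; [nra|apply pow_lt; lra]. }
  assert (0 <= (1 - 2 * mass (s r) (w r)) * mass (s r) (w r) * - S r / r).
  { apply Rdiv_le_0_compat; [|lra].
    apply Rmult_le_pos; [apply Rmult_le_pos|]; lra. }
  unfold Rdiv in *; lra.
Qed.

(** This transfers a drop of [gap_energy] to [energy]; the terms in [B] cancel in the derivative of
    the difference. *)
Lemma flow_energy_sub_gap_energy_nonincreasing (s w S B : R -> R) (a b : R) :
  flow s w S B -> 0 < a <= b ->
  (forall r, a <= r <= b -> mass (s r) (w r) <= 1 / 2 /\ 0 <= S r) ->
  energy s w S B b - gap_energy s w B b <= energy s w S B a - gap_energy s w B a.
Proof.
intros H Hab Hm.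
apply (ge_of_derive_nonpos (fun r => energy s w S B r - gap_energy s w B r)
  (fun r => - (2 * (S r ^ 2 + B r ^ 2 / 12) / r ^ 3) -
            ((1 - 2 * mass (s r) (w r)) * mass (s r) (w r) * S r / r
            - B r ^ 2 / 6 / r ^ 3))); [lra| |].
- intros r Hr.
  apply (is_derive_minus (energy s w S B) (gap_energy s w B)).
  + apply flow_derive_energy; [exact H|lra].
  + apply (flow_derive_gap_energy s w S B); [exact H|lra].
- intros r Hr; destruct (Hm r) as [Hm1 Hm2]; [lra|].
  assert (Hm3 := mass_pos (s r) (w r)).
  assert (0 <= 2 * S r ^ 2 / r ^ 3).
  { apply Rdiv_le_0_compat; [nra|apply pow_lt; lra]. }
  assert (0 <= (1 - 2 * mass (s r) (w r)) * mass (s r) (w r) * S r / r).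
  { apply Rdiv_le_0_compat; [|lra].
    apply Rmult_le_pos; [apply Rmult_le_pos|]; lra. }
  unfold Rdiv in *; lra.
Qed.

(** The rising half of an arch of [w], from a simple zero [z] to a critical point [q]. The bound on
    [mass] at [q] is what the second-order condition at a maximum gives; negative arches are humps
    of [- w]. *)
Definition hump (s w S B : R -> R) (z q : R) : Prop :=
  0 < z < q /\ w z = 0 /\ (forall r, z < r <= q -> 0 < w r) /\ 0 < B z /\ B q = 0 /\
  mass (s q) (w q) <= 1 / 2.

Lemma hump_nonneg (s w S B : R -> R) (z q r : R) :
  hump s w S B z q -> z <= r <= q -> 0 <= w r.
Proof.
intros [_ [Hz [Hw _]]] Hr; destruct (Req_dec r z) as [->|]; [lra|].
left; apply Hw; lra.
Qed.

Lemma flow_B_nonincreasing (s w S B : R -> R) (a b : R) :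
  flow s w S B -> 0 < a <= b ->
  (forall r, a <= r <= b -> mass (s r) (w r) <= 1 / 2) ->
  (forall r, a <= r <= b -> 0 <= w r) -> B b <= B a.
Proof.
intros H Hab Hm Hw.
apply (ge_of_derive_nonpos B
  (fun r => - (3 * r * gap (s r) (w r) * (1 - 2 * mass (s r) (w r))))); [lra| |].
- intros r Hr; apply H; lra.
- intros r Hr.
  assert (Hg : 0 <= gap (s r) (w r)).
  { destruct (Req_dec (w r) 0) as [->|]; [rewrite gap_0; lra|].
    left; apply gap_pos; specialize (Hw r); lra. }
  assert (mass (s r) (w r) <= 1 / 2) by (apply Hm; lra).
  assert (0 <= r * gap (s r) (w r) * (1 - 2 * mass (s r) (w r))); [|nra].
  apply Rmult_le_pos; [apply Rmult_le_pos|]; lra.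
Qed.

(** [w] cannot turn back quickly: on an interval shorter than 1/2, [B] loses at most a fixed
    fraction of [B z], so it cannot reach 0. *)
Lemma hump_length (s w S B : R -> R) (z q : R) :
  flow s w S B -> hump s w S B z q -> 1 <= z ->
  (forall r, z <= r <= q -> mass (s r) (w r) <= 1 / 2) -> 1 / 2 <= q - z.
Proof.
intros H Hh Hz1 Hm.
assert (Hnn := fun r => hump_nonneg _ _ _ _ _ _ r Hh).
destruct Hh as [Hzq [Hwz [Hw [HBz [HBq _]]]]].
apply Rnot_lt_le; intros Hlen.
assert (HB : forall r, z <= r <= q -> B r <= B z).
{ intros r Hr; apply (flow_B_nonincreasing s w S B); [exact H|lra| |].
  - intros t Ht; apply Hm; lra.
  - intros t Ht; apply Hnn; lra. }
assert (Hwle : forall r, z <= r <= q -> w r <= B z / z * (r - z)).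
{ intros r Hr.
  assert (K : w r - B z / z * (r - z) <= w z - B z / z * (z - z)); [|lra].
  apply (ge_of_derive_nonpos (fun r => w r - B z / z * (r - z))
    (fun r => B r / r - B z / z)); [lra| |].
  - intros t Ht; flow_derive H t; ring.
  - intros t Ht.
    assert (B t <= B z) by (apply HB; lra).
    assert (B t / t <= B z / z); [|lra].
    apply Rle_div_l; [lra|].
    replace (B z / z * t) with (B z + B z * (t - z) / z) by (field; lra).
    assert (0 <= B z * (t - z) / z) by (apply Rdiv_le_0_compat; nra); lra. }
(* [9/32 = 3 (1/8) (3/4)]: the maximum of [p (1 - 2 p)] is 1/8, and [t (t - z) / z <= 3/4] because
   [z >= 1] and [t - z < 1/2]. *)
assert (K : B z + 9 / 32 * B z * (z - z) <= B q + 9 / 32 * B z * (q - z)).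
{ apply (le_of_derive_nonneg (fun r => B r + 9 / 32 * B z * (r - z))
    (fun r => - (3 * r * gap (s r) (w r) * (1 - 2 * mass (s r) (w r)))
              + 9 / 32 * B z)); [lra| |].
  - intros t Ht; flow_derive H t; ring.
  - intros t Ht.
    assert (Hwt : w t <= B z / z * (t - z)) by (apply Hwle; lra).
    assert (Hw0 : 0 <= w t) by (apply Hnn; lra).
    assert (Hg := gap_le_mul (s t) (w t) Hw0).
    assert (Hm1 : mass (s t) (w t) <= 1 / 2) by (apply Hm; lra).
    assert (Hm0 := mass_pos (s t) (w t)).
    set (p := mass (s t) (w t)) in *.
    assert (H1 : gap (s t) (w t) * (1 - 2 * p) <= 1 / 8 * w t).
    { apply Rle_trans with (p * w t * (1 - 2 * p)).
      - apply Rmult_le_compat_r; lra.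
      - assert (p * (1 - 2 * p) <= 1 / 8) by (assert (H1 := pow2_ge_0 (p - 1 / 4)); lra). nra. }
    assert (H2 : t * w t <= 3 / 4 * B z).
    { apply Rle_trans with (t * (B z / z * (t - z))); [apply Rmult_le_compat_l; lra|].
      replace (t * (B z / z * (t - z))) with (B z * (t * (t - z)) / z) by (field; lra).
      apply Rle_div_l; [lra|].
      assert (t * (t - z) <= 3 / 4 * z) by nra. nra. }
    nra. }
nra.
Qed.

Lemma flow_s_nondecreasing (s w S B : R -> R) (a b : R) :
  flow s w S B -> 0 < a <= b -> (forall r, a <= r <= b -> 0 <= S r) -> s a <= s b.
Proof.
intros H Hab HS.
apply (le_of_derive_nonneg s (fun r => S r / r)); [lra| |].
- intros r Hr; apply H; lra.
- intros r Hr; apply Rdiv_le_0_compat; [apply HS|]; lra.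
Qed.

(** If [S z] were small, so would be the kinetic part of [energy]; the potential then bounds
    [e^(s z)] from below, and [S] decreases too fast to remain nonnegative up to [q]. *)
Lemma hump_S_lower_bound (s w S B : R -> R) (z q : R) :
  flow s w S B -> hump s w S B z q -> 1 <= z ->
  (forall r, z <= r <= q -> mass (s r) (w r) <= 1 / 2) ->
  (forall r, z <= r <= q -> 0 <= S r) -> Rabs (B z) <= 6 * S z ->
  1 / 4 <= energy s w S B z -> z / 100 <= S z.
Proof.
intros H Hh Hz1 Hm HS HB HE.
assert (Hlen := hump_length s w S B z q H Hh Hz1 Hm).
destruct Hh as [Hzq [Hwz _]].
apply Rnot_lt_le; intros Hlt.
assert (HSz : 0 <= S z) by (apply HS; lra).
assert (HK : (S z ^ 2 + B z ^ 2 / 12) / z ^ 2 <= 1 / 16).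
{ assert (HB2 : B z ^ 2 <= 36 * S z ^ 2).
  { rewrite <- (pow2_abs (B z)); assert (H0 := Rabs_pos (B z)); nra. }
  apply Rle_div_l; [apply pow_lt; lra|]. nra. }
unfold energy in HE; rewrite Hwz, mass_0 in HE.
set (x := exp (s z)) in HE.
assert (Hx0 : 0 < x) by apply exp_pos.
assert (Hx2 : exp (2 * s z) = x * x).
{ unfold x; rewrite <- exp_plus; f_equal; ring. }
(* At [w z = 0] the potential is [2 x - x^2]; with a kinetic part of at most 1/16 it must be at
   least 3/16. *)
assert (Hx : 3 / 32 <= x) by nra.
(* The slope comes from [force >= 6 x^2 >= 54/1024] and [r >= z]. Over a length of at least 1/2, [S]
   loses [27/2048 z], more than [z/100]. *)
assert (K : S q + 27 / 1024 * z * (q - z) <= S z + 27 / 1024 * z * (z - z)).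
{ apply (ge_of_derive_nonpos (fun r => S r + 27 / 1024 * z * (r - z))
    (fun r => - (r * force (s r) (w r) / 2) + 27 / 1024 * z)); [lra| |].
  - intros r Hr; flow_derive H r; field.
  - intros r Hr.
    assert (Hs : s z <= s r).
    { apply (flow_s_nondecreasing s w S B); [exact H|lra|].
      intros t Ht; apply HS; lra. }
    assert (He : x * x <= exp (2 * s r)).
    { rewrite <- Hx2; destruct Hs as [Hs|Hs]; [left; apply exp_increasing; lra|].
      rewrite Hs; lra. }
    assert (Hm0 := mass_pos (s r) (w r)).
    assert (mass (s r) (w r) <= 1 / 2) by (apply Hm; lra).
    assert (Hf : 27 / 512 <= force (s r) (w r)) by (unfold force; nra).
    nra. }
assert (0 <= S q) by (apply HS; lra).
nra.
Qed.

(** [mass] cannot be increasing at the entry point [e], which bounds [|B e|] below by a multiple of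
    [S e]; by [q], where [B] vanishes, [gap_energy] has lost its whole [B] term. *)
Lemma hump_energy_drop (s w S B : R -> R) (e z q : R) :
  flow s w S B -> hump s w S B z q -> 1 <= e < q ->
  (forall r, e <= r <= q -> mass (s r) (w r) <= 1 / 2) ->
  mass (s e) (w e) = 1 / 2 -> 0 <= S q -> 1 / 4 <= energy s w S B z ->
  energy s w S B q <= energy s w S B e - 1 / 30000.
Proof.
intros H Hh Heq Hm Hme HSq HE.
assert (HS : forall r, e <= r < q -> 0 < S r).
{ intros r Hr; enough (S q < S r) by lra.
  apply (flow_S_decreasing s w S B); [exact H|lra|].
  intros t Ht; apply Hm; lra. }
assert (HSn : forall r, e <= r <= q -> 0 <= S r).
{ intros r Hr; destruct (Req_dec r q) as [->|]; [exact HSq|].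
  left; apply HS; lra. }
assert (HBq : B q = 0) by apply Hh.
assert (HB : forall r, e <= r <= q -> Rabs (B r) <= 6 * S r).
{ intros r Hr.
  assert (K1 := flow_B_add_S_le s w S B r q H ltac:(lra)).
  assert (K2 := flow_B_sub_S_ge s w S B r q H ltac:(lra)).
  assert (Hm' : forall t, r <= t <= q -> mass (s t) (w t) <= 1 / 2).
  { intros t Ht; apply Hm; lra. }
  specialize (K1 Hm'); specialize (K2 Hm'); apply Rabs_le; lra. }
(* [mass] equals 1/2 at [e] and is at most 1/2 on [[e, q]], so its derivative at [e] is
   nonpositive. *)
assert (Hentry : mass (s e) (w e) * S e + gap (s e) (w e) * B e / 2 <= 0).
{ apply Rnot_lt_le; intros Hlt.
  assert (Hd := flow_derive_mass s w S B e H ltac:(lra)).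
  destruct (is_derive_pos_strict _ _ _ Hd) as [delta [Hd0 [Hd1 _]]].
  { apply Rdiv_lt_0_compat; [exact Hlt|lra]. }
  set (r := Rmin q (e + delta / 2)).
  assert (Hr : e < r <= q /\ r <= e + delta / 2).
  { unfold r; split; [split|]; [apply Rmin_glb_lt; lra|apply Rmin_l|apply Rmin_r]. }
  assert (K := Hd1 r ltac:(lra)).
  assert (mass (s r) (w r) <= 1 / 2) by (apply Hm; lra).
  simpl in K; lra. }
assert (HSe : 0 < S e) by (apply HS; lra).
assert (Hg := gap_le_mass (s e) (w e)).
assert (HBe : 4 * S e ^ 2 <= B e ^ 2).
{ assert (2 * S e <= Rabs (B e)); [|rewrite <- (pow2_abs (B e)); nra].
  apply Rnot_lt_le; intros Hlt; apply Rabs_def2 in Hlt; nra. }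
(* If [e] were past [z], then [w > 0] on [[e, q]] and [B] would descend to 0 there, so [B e >= 0],
   against the entry condition. *)
assert (Hez : e <= z).
{ apply Rnot_lt_le; intros Hlt.
  destruct Hh as [_ [_ [Hw _]]].
  assert (Hwe : 0 < w e) by (apply Hw; lra).
  assert (Hge := gap_pos (s e) (w e) Hwe).
  assert (B q <= B e); [|nra].
  apply (flow_B_nonincreasing s w S B); [exact H|lra|exact Hm|].
  intros r Hr; left; apply Hw; lra. }
assert (Hzq : z < q) by apply Hh.
assert (HSz : z / 100 <= S z).
{ apply (hump_S_lower_bound s w S B z q); [exact H|exact Hh|lra| | | |exact HE].
  - intros r Hr; apply Hm; lra.
  - intros r Hr; apply HSn; lra.
  - apply HB; lra. }
assert (HSez : S z <= S e).
{ destruct (Req_dec e z) as [->|]; [lra|left].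
  apply (flow_S_decreasing s w S B); [exact H|lra|].
  intros t Ht; apply Hm; lra. }
assert (HD := flow_energy_sub_gap_energy_nonincreasing s w S B e q H ltac:(lra)
  (fun r Hr => conj (Hm r Hr) (HSn r Hr))).
enough (gap_energy s w B q <= gap_energy s w B e - 1 / 30000) by lra.
unfold gap_energy; rewrite HBq, Hme.
(* [S e >= S z >= z/100 >= e/100] and [B e ^ 2 >= 4 S e ^ 2] give [4/120000]. *)
assert (1 / 30000 <= B e ^ 2 / 12 / e ^ 2).
{ apply (Rle_div_r (1 / 30000)); [apply pow_lt; lra|]. nra. }
assert (mass (s q) (w q) <= 1 / 2) by (apply Hm; lra).
assert (0 ^ 2 / 12 / q ^ 2 = 0) by (field; lra).
nra.
Qed.

(** * Peaks at which the half-sum decreases *)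

(** Moving slightly to the right makes the inequalities strict, as [mass_stays_small] requires. The
    delicate case is [mass = 1/2] at [q], where [gap_energy] is exactly 1/4. *)
Lemma right_of_critical_point (s w S B : R -> R) (q : R) :
  flow s w S B -> 0 < q -> B q = 0 -> mass (s q) (w q) <= 1 / 2 -> S q <= 0 ->
  exists r, q < r /\ mass (s r) (w r) < 1 / 2 /\ S r < 0 /\ gap_energy s w B r < 1 / 4.
Proof.
intros H Hq HBq Hmq HSq.
assert (HS' : is_derive S q (- (q * force (s q) (w q) / 2))) by apply (H q Hq).
assert (Hf := force_pos _ _ Hmq).
destruct (is_derive_neg_strict _ _ _ HS') as [d1 [Hd1 [HS _]]]; [nra|].
assert (HF := flow_derive_gap_energy s w S B q H Hq).
assert (HFq : gap_energy s w B q = mass (s q) (w q) - mass (s q) (w q) ^ 2).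
{ unfold gap_energy; rewrite HBq; field; lra. }
destruct (Req_dec (mass (s q) (w q)) (1 / 2)) as [Hm|Hm].
(* [g] is [r] times the derivative of [mass]. At [q] it equals [S q / 2]; when this vanishes, the
   derivative of [g] there is [- q force / 4 < 0]. *)
- set (g := fun r => mass (s r) (w r) * S r + gap (s r) (w r) * B r / 2).
  assert (Hg : is_derive g q
    ((mass (s q) (w q) * S q + gap (s q) (w q) * B q / 2) / q * S q +
     mass (s q) (w q) * - (q * force (s q) (w q) / 2) +
     ((gap (s q) (w q) * S q + mass (s q) (w q) * B q / 2) / q * B q +
     gap (s q) (w q) * - (3 * q * gap (s q) (w q) * (1 - 2 * mass (s q) (w q)))) / 2)).
  { unfold g, mass, gap; flow_derive H q; unfold force, mass, gap.
    unfold Rminus, Rdiv; field; lra. }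
  assert (Hneg : exists d2, 0 < d2 /\ forall r, q < r < q + d2 -> g r < 0).
  { destruct (Req_dec (S q) 0) as [HS0|HS0].
    - destruct (is_derive_neg_strict _ _ _ Hg) as [d2 [Hd2 [Hg2 _]]].
      + rewrite HS0, HBq, Hm; nra.
      + exists d2; split; [exact Hd2|intros r Hr].
        assert (g q = 0) by (unfold g; rewrite HS0, HBq; field).
        specialize (Hg2 r Hr); lra.
    - destruct (continuous_lt g q 0) as [d2 [Hd2 Hg2]].
      + apply (ex_derive_continuous g); eexists; exact Hg.
      + unfold g; rewrite HBq, Hm; lra.
      + exists d2; split; [exact Hd2|intros r Hr; apply Hg2; rewrite Rabs_right; lra]. }
  destruct Hneg as [d2 [Hd2 Hneg]].
  assert (Hr : exists r, q < r < q + d1 /\ r < q + d2).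
  { exists (q + Rmin d1 d2 / 2); assert (H1 := Rmin_l d1 d2); assert (H2 := Rmin_r d1 d2).
    assert (0 < Rmin d1 d2) by (apply Rmin_glb_lt; lra); lra. }
  destruct Hr as [r Hr].
  assert (Hmr : forall t, q < t <= r -> mass (s t) (w t) < 1 / 2).
  { intros t Ht; rewrite <- Hm.
    apply (gt_of_derive_neg (fun t => mass (s t) (w t)) (fun t => g t / t)); [lra| |].
    - intros x Hx; apply (flow_derive_mass s w S B); [exact H|lra].
    - intros x Hx; assert (g x < 0) by (apply Hneg; lra).
      apply Rdiv_neg_pos; lra. }
  exists r; split; [lra|split; [apply Hmr; lra|split]].
  + specialize (HS r ltac:(lra)); lra.
  + apply Rlt_le_trans with (gap_energy s w B q); [|rewrite HFq, Hm; lra].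
    apply (gt_of_derive_neg _ (fun r => (1 - 2 * mass (s r) (w r)) * mass (s r) (w r) * S r / r
            - B r ^ 2 / 6 / r ^ 3)); [lra| |].
    * intros t Ht; apply (flow_derive_gap_energy s w S B); [exact H|lra].
    * intros t Ht.
      assert (mass (s t) (w t) < 1 / 2) by (apply Hmr; lra).
      assert (Hm3 := mass_pos (s t) (w t)).
      assert (HSt := HS t ltac:(lra)).
      assert (0 <= B t ^ 2 / 6 / t ^ 3).
      { apply Rdiv_le_0_compat; [nra|apply pow_lt; lra]. }
      assert ((1 - 2 * mass (s t) (w t)) * mass (s t) (w t) * S t / t < 0); [|lra].
      apply Rdiv_neg_pos; [|lra].
      assert (0 < (1 - 2 * mass (s t) (w t)) * mass (s t) (w t)) by (apply Rmult_lt_0_compat; lra).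
      nra.
- destruct (continuous_lt (fun r => mass (s r) (w r)) q (1 / 2)) as [d2 [Hd2 H2]];
    [apply (flow_continuous_mass s w S B); assumption|lra|].
  destruct (continuous_lt (gap_energy s w B) q (1 / 4)) as [d3 [Hd3 H3]].
  { apply (ex_derive_continuous (gap_energy s w B)); eexists; exact HF. }
  { rewrite HFq; assert (H0 := mass_pos (s q) (w q)); nra. }
  set (d := Rmin d1 (Rmin d2 d3)).
  assert (Hd : 0 < d /\ d <= d1 /\ d <= d2 /\ d <= d3).
  { unfold d; assert (H4 := Rmin_l d1 (Rmin d2 d3)); assert (H5 := Rmin_r d1 (Rmin d2 d3)).
    assert (H6 := Rmin_l d2 d3); assert (H7 := Rmin_r d2 d3).
    split; [|lra]. repeat apply Rmin_glb_lt; lra. }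
  exists (q + d / 2).
  split; [lra|split; [|split]].
  + apply H2; rewrite Rabs_right; lra.
  + specialize (HS (q + d / 2) ltac:(lra)); lra.
  + apply H3; rewrite Rabs_right; lra.
Qed.

(** While [mass <= 1/2], [S] stays negative and [gap_energy] does not increase, so [mass - mass^2]
    is bounded by a constant below 1/4 and [mass] never reaches 1/2. *)
Lemma mass_stays_small (s w S B : R -> R) (a r : R) :
  flow s w S B -> 0 < a <= r -> mass (s a) (w a) < 1 / 2 -> S a < 0 ->
  gap_energy s w B a < 1 / 4 ->
  S r < 0 /\ 1 - 4 * gap_energy s w B a <= 1 - 2 * mass (s r) (w r).
Proof.
intros H Har Hma HSa HFa.
assert (Hle : forall b, a <= b -> (forall t, a <= t <= b -> mass (s t) (w t) <= 1 / 2) ->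
  S b < 0 /\ mass (s b) (w b) - mass (s b) (w b) ^ 2 <= gap_energy s w B a).
{ intros b Hb Hm.
  assert (HS : forall t, a <= t <= b -> S t < 0).
  { intros t Ht; destruct (Req_dec t a) as [->|]; [exact HSa|].
    apply Rlt_trans with (S a); [|exact HSa].
    apply (flow_S_decreasing s w S B); [exact H|lra|].
    intros x Hx; apply Hm; lra. }
  split; [apply HS; lra|].
  assert (HF : gap_energy s w B b <= gap_energy s w B a).
  { apply (flow_gap_energy_nonincreasing s w S B); [exact H|lra|].
    intros t Ht; split; [apply Hm|left; apply HS]; lra. }
  unfold gap_energy in HF at 1.
  assert (0 <= B b ^ 2 / 12 / b ^ 2).
  { apply Rdiv_le_0_compat; [nra|apply pow_lt; lra]. }
  lra. }
assert (Hm : forall t, a <= t <= r -> mass (s t) (w t) <= 1 / 2).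
{ intros t Ht; apply Rnot_lt_le; intros Hlt.
  destruct (first_crossing (fun t => mass (s t) (w t)) a t (1 / 2)) as [e [He [Hme Hmt]]].
  - lra.
  - intros x Hx; apply (flow_continuous_mass s w S B); [exact H|lra].
  - lra.
  - exact Hlt.
  - destruct (Hle e) as [_ K]; [lra|exact Hmt|].
    simpl in Hme; rewrite Hme in K; lra. }
destruct (Hle r) as [HS K]; [lra|exact Hm|].
split; [exact HS|].
assert (H1 := mass_pos (s r) (w r)).
assert (H2 : mass (s r) (w r) <= 1 / 2) by (apply Hm; lra).
(* For [mass <= 1/2] one has [mass - mass^2 >= mass / 2]. *)
nra.
Qed.

(* [r^2 E] grows at most like [- S], while [S^2 <= r^2 E]. *)
Lemma S_bounded_below (s w S B : R -> R) (a k : R) :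
  flow s w S B -> 0 < a -> 0 < k ->
  (forall r, a <= r -> S r <= 0 /\ k <= 1 - 2 * mass (s r) (w r)) ->
  exists M, forall r, a <= r -> - M <= S r.
Proof.
intros H Ha Hk Hr.
set (D := fun r => r ^ 2 * energy s w S B r).
set (C0 := Rabs (D a + 8 / k * S a)).
assert (HC0 : 0 <= C0) by apply Rabs_pos.
assert (Hk' : 0 < 8 / k) by (apply Rdiv_lt_0_compat; lra).
exists (1 + 8 / k + C0); intros r Har.
(* [D' <= 4 r mass] while [S' <= - k r mass / 2], so the factor [8 / k] balances the two. *)
assert (K : D r + 8 / k * S r <= D a + 8 / k * S a).
{ apply (ge_of_derive_nonpos (fun r => D r + 8 / k * S r)
    (fun r => 2 * r * (mass (s r) (w r) - mass (s r) (w r) ^ 2 + 3 * exp (2 * s r))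
              + 8 / k * - (r * force (s r) (w r) / 2))); [lra| |].
  - intros t Ht; unfold D.
    assert (HE := flow_derive_energy s w S B t H ltac:(lra)).
    destruct (H t ltac:(lra)) as [_ [_ [H3 _]]].
    auto_derive; [split; [eexists; exact HE|split; [eexists; exact H3|exact I]]|].
    rewrite_derive HE; rewrite_derive H3; unfold energy; field; lra.
  - intros t Ht; destruct (Hr t ltac:(lra)) as [_ Hm].
    assert (H1 := mass_pos (s t) (w t)).
    assert (H2 := potential_le (s t) (w t)).
    assert (H3 := exp_pos (2 * s t)).
    assert (H4 : 4 * mass (s t) (w t) <= 8 / k * (force (s t) (w t) / 2)).
    { unfold force.
      apply Rle_trans with (8 / k * (mass (s t) (w t) * k / 2)).
      - right; field; lra.
      - apply Rmult_le_compat_l; [lra|]. nra. }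
    assert (H5 : mass (s t) (w t) - mass (s t) (w t) ^ 2 + 3 * exp (2 * s t)
                 <= 2 * mass (s t) (w t)) by nra.
    replace (8 / k * - (t * force (s t) (w t) / 2))
      with (- (t * (8 / k * (force (s t) (w t) / 2)))) by (field; lra).
    assert (t * (4 * mass (s t) (w t)) <= t * (8 / k * (force (s t) (w t) / 2)))
      by (apply Rmult_le_compat_l; lra).
    nra. }
assert (HD : S r ^ 2 <= D r).
{ unfold D, energy.
  destruct (Hr r Har) as [_ Hm].
  assert (H1 := mass_pos (s r) (w r)).
  assert (H3 := exp_pos (2 * s r)).
  rewrite Rmult_plus_distr_l.
  replace (r ^ 2 * ((S r ^ 2 + B r ^ 2 / 12) / r ^ 2)) with (S r ^ 2 + B r ^ 2 / 12)
    by (field; lra).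
  assert (0 <= mass (s r) (w r) - mass (s r) (w r) ^ 2 + 3 * exp (2 * s r)) by nra.
  assert (0 <= r ^ 2 * (mass (s r) (w r) - mass (s r) (w r) ^ 2 + 3 * exp (2 * s r))).
  { apply Rmult_le_pos; [apply pow2_ge_0|assumption]. }
  nra. }
assert (HC : D a + 8 / k * S a <= C0) by apply Rle_abs.
destruct (Hr r Har) as [HS _].
apply Rnot_lt_le; intros Hlt.
set (x := - S r) in *.
assert (Hx : S r = - x) by (unfold x; ring).
rewrite Hx in *.
assert (x ^ 2 <= C0 + 8 / k * x) by lra.
assert (1 + 8 / k + C0 < x) by lra.
assert ((1 + 8 / k + C0) * x < x * x) by (apply Rmult_lt_compat_r; lra).
nra.
Qed.

(** Otherwise [r^2 mass >= c] from some point on, so [S' <= - k c / (2 r)] and [S] falls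
    logarithmically below [- M]. *)
Lemma sqr_mass_small (s w S B : R -> R) (a k M c R0 : R) :
  flow s w S B -> 0 < a -> 0 < k -> 0 < c ->
  (forall r, a <= r -> - M <= S r /\ k <= 1 - 2 * mass (s r) (w r)) ->
  exists r, R0 <= r /\ a <= r /\ r ^ 2 * mass (s r) (w r) < c.
Proof.
intros H Ha Hk Hc Hr.
apply NNPP; intros Hno.
set (b := Rmax a R0).
assert (Hb1 : a <= b) by apply Rmax_l.
assert (Hb2 : R0 <= b) by apply Rmax_r.
assert (Hge : forall r, b <= r -> c <= r ^ 2 * mass (s r) (w r)).
{ intros r Hbr; apply Rnot_lt_le; intros Hlt; apply Hno; exists r; repeat split; lra. }
(* At this radius the logarithmic bound reads [S r <= S b - 1 - |M + S b| < - M]. *)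
set (r := exp (ln b + 2 / (k * c) * (1 + Rabs (M + S b)))).
assert (Hkc : 0 < k * c) by (apply Rmult_lt_0_compat; lra).
assert (Hln : ln r = ln b + 2 / (k * c) * (1 + Rabs (M + S b))) by apply ln_exp.
assert (Hpos : 0 <= 2 / (k * c) * (1 + Rabs (M + S b))).
{ apply Rmult_le_pos; [left; apply Rdiv_lt_0_compat; lra|].
  assert (H0 := Rabs_pos (M + S b)); lra. }
assert (Hbr : b <= r).
{ rewrite <- (exp_ln b) by lra; unfold r.
  destruct Hpos as [Hpos|Hpos]; [left; apply exp_increasing; lra|].
  rewrite <- Hpos, Rplus_0_r; lra. }
assert (K : S r + k * c / 2 * ln r <= S b + k * c / 2 * ln b).
{ apply (ge_of_derive_nonpos (fun r => S r + k * c / 2 * ln r)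
    (fun r => - (r * force (s r) (w r) / 2) + k * c / 2 / r)); [lra| |].
  - intros t Ht; flow_derive H t; field; lra.
  - intros t Ht.
    destruct (Hr t ltac:(lra)) as [_ Hm].
    assert (Hg := Hge t ltac:(lra)).
    assert (H1 := mass_pos (s t) (w t)).
    assert (H3 := exp_pos (2 * s t)).
    assert (H4 : mass (s t) (w t) * k <= force (s t) (w t)) by (unfold force; nra).
    assert (k * c / 2 / t <= t * (mass (s t) (w t) * k) / 2); [|nra].
    apply (Rle_div_l (k * c / 2)); [lra|]. nra. }
rewrite Hln in K.
replace (k * c / 2 * (ln b + 2 / (k * c) * (1 + Rabs (M + S b)))) with
  (k * c / 2 * ln b + (1 + Rabs (M + S b))) in K by (field; lra).
assert (H0 := Rle_abs (M + S b)).
destruct (Hr r ltac:(lra)) as [HS _]; lra.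
Qed.

(** If [S >= -2] throughout, [s + 2 ln r] is nondecreasing, so [r^2 e^s], and with it [r^2 mass],
    stays away from 0, against [sqr_mass_small]. *)
Lemma S_below_minus_two (s w S B : R -> R) (a k M : R) :
  flow s w S B -> 0 < a -> 0 < k ->
  (forall r, a <= r -> - M <= S r /\ k <= 1 - 2 * mass (s r) (w r)) ->
  exists r, a <= r /\ S r < - 2.
Proof.
intros H Ha Hk Hr.
apply NNPP; intros Hno.
assert (Hge : forall r, a <= r -> - 2 <= S r).
{ intros r Har; apply Rnot_lt_le; intros Hlt; apply Hno; exists r; split; lra. }
destruct (sqr_mass_small s w S B a k M (2 * exp (s a + 2 * ln a)) a H Ha Hk) as [r [Har [_ Hlt]]].
{ assert (H0 := exp_pos (s a + 2 * ln a)); lra. }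
{ exact Hr. }
assert (K : s a + 2 * ln a <= s r + 2 * ln r).
{ apply (le_of_derive_nonneg (fun r => s r + 2 * ln r) (fun r => (S r + 2) / r)); [lra| |].
  - intros t Ht; flow_derive H t; field; lra.
  - intros t Ht; assert (H1 := Hge t ltac:(lra)).
    apply Rdiv_le_0_compat; lra. }
assert (Hexp : exp (s a + 2 * ln a) <= exp (s r + 2 * ln r)).
{ destruct K as [K|K]; [left; apply exp_increasing, K|rewrite K; lra]. }
assert (Hr2 : exp (s r + 2 * ln r) = exp (s r) * (r * r)).
{ replace (2 * ln r) with (ln r + ln r) by ring.
  rewrite !exp_plus, exp_ln by lra; reflexivity. }
rewrite Hr2 in Hexp.
assert (Hm := exp_le_mass (s r) (w r)).
assert (r ^ 2 * (2 * exp (s r)) <= r ^ 2 * mass (s r) (w r)).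
{ apply Rmult_le_compat_l; [apply pow2_ge_0|exact Hm]. }
nra.
Qed.

(** [- S] is increasing and bounded, hence within [eps / 6] of its supremum past some [b]; by the
    monotonicity of [B + 6 S] and [B - 6 S], [|B r|] is at most [6 (S r - S q)]. *)
Lemma B_small_before_zero (s w S B : R -> R) (a M eps : R) :
  flow s w S B -> 0 < a -> 0 < eps ->
  (forall r, a <= r -> - M <= S r /\ mass (s r) (w r) <= 1 / 2) ->
  exists b, a <= b /\
    forall r q, b <= r <= q -> B q = 0 -> Rabs (B r) <= eps.
Proof.
intros H Ha Heps Hr.
destruct (completeness (fun x => exists r, a <= r /\ x = - S r)) as [m [Hm1 Hm2]].
{ exists M; intros x [r [Har ->]]; destruct (Hr r Har); lra. }
{ exists (- S a); exists a; split; [lra|reflexivity]. }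
assert (Hb : exists b, a <= b /\ m - eps / 6 < - S b).
{ apply NNPP; intros Hno.
  assert (m <= m - eps / 6); [|lra].
  apply Hm2; intros x [r [Har ->]]; apply Rnot_lt_le; intros Hlt.
  apply Hno; exists r; split; assumption. }
destruct Hb as [b [Hab Hb]].
exists b; split; [exact Hab|].
intros r q Hrq HBq.
assert (Hmass : forall t, r <= t <= q -> mass (s t) (w t) <= 1 / 2).
{ intros t Ht; apply Hr; lra. }
assert (K1 := flow_B_add_S_le s w S B r q H ltac:(lra) Hmass).
assert (K2 := flow_B_sub_S_ge s w S B r q H ltac:(lra) Hmass).
assert (HSr : S r <= S b).
{ destruct (Req_dec b r) as [->|]; [lra|left].
  apply (flow_S_decreasing s w S B); [exact H|lra|].
  intros t Ht; apply Hr; lra. }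
assert (HSq : - S q <= m) by (apply Hm1; exists q; split; [lra|reflexivity]).
apply Rabs_le; lra.
Qed.

(* [r^2 mass] dominates the coefficient of the equation for [w] in the variable
   [ln r], and it decays too fast there for [w] to turn back. *)
Lemma decaying_hump_absurd (s w S B : R -> R) (eta z q : R) :
  flow s w S B -> hump s w S B z q -> 0 < eta ->
  (forall r, z <= r <= q -> mass (s r) (w r) <= 1 / 2 /\ 2 + S r + Rabs (B r) / 2 <= - eta) ->
  3 * (z ^ 2 * mass (s z) (w z)) < eta ^ 2 -> False.
Proof.
intros H Hh Heta Hr Hsmall.
assert (Hnn := fun r => hump_nonneg s w S B z q r Hh).
destruct Hh as [Hzq [Hwz [Hw [HBz [HBq _]]]]].
assert (HB : forall r, z <= r <= q -> B r <= B z).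
{ intros r Hr'; apply (flow_B_nonincreasing s w S B); [exact H|lra| |].
  - intros t Ht; apply Hr; lra.
  - intros t Ht; apply Hnn; lra. }
assert (Hwle : forall r, z <= r <= q -> w r <= B z * (ln r - ln z)).
{ intros r Hr'.
  assert (K : w r - B z * (ln r - ln z) <= w z - B z * (ln z - ln z)); [|lra].
  apply (ge_of_derive_nonpos (fun r => w r - B z * (ln r - ln z))
    (fun r => - ((B z - B r) / r))); [lra| |].
  - intros t Ht; flow_derive H t; field; lra.
  - intros t Ht; assert (H1 := HB t ltac:(lra)).
    assert (0 <= (B z - B t) / t) by (apply Rdiv_le_0_compat; lra); lra. }
(* With [x = ln r - ln z], the barrier imitates the antiderivative [- (x + 1/eta) e^(- eta x) / eta]
   of [x e^(- eta x)]: [w] grows at most like [B z x] and [r^2 mass] decays at rate [eta] in [x]. *)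
set (L := fun r => ln r - ln z + 1 / eta).
assert (K : B z - 3 * B z / eta * (z ^ 2 * mass (s z) (w z)) * L z
         <= B q - 3 * B z / eta * (q ^ 2 * mass (s q) (w q)) * L q).
{ apply (le_of_derive_nonneg
    (fun r => B r - 3 * B z / eta * (r ^ 2 * mass (s r) (w r)) * L r)
    (fun r => - (3 * r * gap (s r) (w r) * (1 - 2 * mass (s r) (w r)))
      - 3 * B z / eta * ((2 * r * mass (s r) (w r)
          + r * (mass (s r) (w r) * S r + gap (s r) (w r) * B r / 2)) * L r
          + r * mass (s r) (w r)))); [lra| |].
  - intros t Ht; unfold L.
    assert (HM := flow_derive_mass s w S B t H ltac:(lra)).
    destruct (H t ltac:(lra)) as [_ [_ [_ H4]]].
    set (p := fun r => mass (s r) (w r)).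
  change (is_derive p t ((mass (s t) (w t) * S t + gap (s t) (w t) * B t / 2) / t)) in HM.
    change (is_derive (fun r => B r - 3 * B z / eta * (r ^ 2 * p r) * (ln r - ln z + 1 / eta)) t
     (- (3 * t * gap (s t) (w t) * (1 - 2 * mass (s t) (w t))) -
      3 * B z / eta * ((2 * t * mass (s t) (w t) +
        t * (mass (s t) (w t) * S t + gap (s t) (w t) * B t / 2)) *
        (ln t - ln z + 1 / eta) + t * mass (s t) (w t)))).
    auto_derive; [repeat split; try lra; eexists; first [exact HM|exact H4]|].
    rewrite_derive HM; rewrite_derive H4; unfold p; field; lra.
  - intros t Ht.
    destruct (Hr t ltac:(lra)) as [Hm HS].
    assert (Hp := mass_pos (s t) (w t)).
    assert (Hg := gap_le_mass (s t) (w t)).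
    assert (Hwt := Hwle t ltac:(lra)).
    assert (Hw0 := Hnn t ltac:(lra)).
    assert (Hgw := gap_le_mul (s t) (w t) Hw0).
    set (p := mass (s t) (w t)) in *; set (g := gap (s t) (w t)) in *.
    assert (HL : 1 / eta <= L t).
    { unfold L; assert (ln z < ln t) by (apply ln_increasing; lra); lra. }
    assert (H1eta : 0 < 1 / eta) by (apply Rdiv_lt_0_compat; lra).
    assert (HgB : g * B t <= p * Rabs (B t)).
    { assert (H0 := Rle_abs (g * B t)); rewrite Rabs_mult in H0.
      assert (Rabs g <= p) by (apply Rabs_le; lra).
      assert (Rabs g * Rabs (B t) <= p * Rabs (B t))
        by (apply Rmult_le_compat_r; [apply Rabs_pos|assumption]); lra. }
    assert (HX : 2 * t * p + t * (p * S t + g * B t / 2) <= - eta * (t * p)).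
    { apply Rle_trans with (t * p * (2 + S t + Rabs (B t) / 2)).
      - assert (t * (g * B t) <= t * (p * Rabs (B t))) by (apply Rmult_le_compat_l; lra); lra.
      - assert (0 < t * p) by (apply Rmult_lt_0_compat; lra); nra. }
    assert (HXL : (2 * t * p + t * (p * S t + g * B t / 2)) * L t <= - eta * (t * p) * L t).
    { apply Rmult_le_compat_r; lra. }
    assert (Hsum : (2 * t * p + t * (p * S t + g * B t / 2)) * L t + t * p
                   <= - eta * (t * p * (ln t - ln z))).
    { assert (Heq : - eta * (t * p) * L t = - eta * (t * p * (ln t - ln z)) - t * p).
      { unfold L; field; lra. }
      lra. }
    assert (Hc : 0 < 3 * B z / eta) by (apply Rdiv_lt_0_compat; lra).
    assert (Hmul := Rmult_le_compat_l _ _ _ (Rlt_le _ _ Hc) Hsum).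
    replace (3 * B z / eta * (- eta * (t * p * (ln t - ln z))))
      with (- (3 * t * p * (B z * (ln t - ln z)))) in Hmul by (field; lra).
    assert (H3 : 3 * t * g * (1 - 2 * p) <= 3 * t * p * (B z * (ln t - ln z))).
    { apply Rle_trans with (3 * t * (p * w t)).
      - assert (0 <= t * p * w t) by (repeat apply Rmult_le_pos; lra).
        assert (t * g <= t * (p * w t)) by (apply Rmult_le_compat_l; lra).
        assert (t * g * (1 - 2 * p) <= t * (p * w t) * (1 - 2 * p))
          by (apply Rmult_le_compat_r; lra).
        nra.
      - assert (t * p * w t <= t * p * (B z * (ln t - ln z))); [|lra].
        apply Rmult_le_compat_l; [|exact Hwt]. apply Rmult_le_pos; lra. }
    lra. }
rewrite HBq in K; unfold L in K.
assert (Hq0 : 0 <= 3 * B z / eta * (q ^ 2 * mass (s q) (w q)) * (ln q - ln z + 1 / eta)).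
{ assert (H1 := mass_pos (s q) (w q)).
  assert (ln z < ln q) by (apply ln_increasing; lra).
  assert (0 < 1 / eta) by (apply Rdiv_lt_0_compat; lra).
  repeat apply Rmult_le_pos; try lra; left; apply Rinv_0_lt_compat; lra. }
replace (ln z - ln z + 1 / eta) with (1 / eta) in K by ring.
assert (HK : B z <= B z * (3 * (z ^ 2 * mass (s z) (w z)) / eta ^ 2)).
{ replace (B z * (3 * (z ^ 2 * mass (s z) (w z)) / eta ^ 2))
    with (3 * B z / eta * (z ^ 2 * mass (s z) (w z)) * (1 / eta)) by (field; lra).
  lra. }
assert (3 * (z ^ 2 * mass (s z) (w z)) / eta ^ 2 < 1).
{ apply Rlt_div_l; [apply pow_lt; lra|lra]. }
nra.
Qed.

Lemma sqr_mass_nonincreasing (s w S B : R -> R) (a b : R) :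
  flow s w S B -> 0 < a <= b ->
  (forall r, a <= r <= b -> 2 + S r + Rabs (B r) / 2 <= 0) ->
  b ^ 2 * mass (s b) (w b) <= a ^ 2 * mass (s a) (w a).
Proof.
intros H Hab Hr.
apply (ge_of_derive_nonpos (fun r => r ^ 2 * mass (s r) (w r))
  (fun r => r * (mass (s r) (w r) * (2 + S r) + gap (s r) (w r) * B r / 2))); [lra| |].
- intros t Ht.
  assert (HM := flow_derive_mass s w S B t H ltac:(lra)).
  set (p := fun r => mass (s r) (w r)).
  change (is_derive p t ((mass (s t) (w t) * S t + gap (s t) (w t) * B t / 2) / t)) in HM.
  change (is_derive (fun r => r ^ 2 * p r) t
    (t * (mass (s t) (w t) * (2 + S t) + gap (s t) (w t) * B t / 2))).
  auto_derive; [eexists; exact HM|].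
  rewrite_derive HM; unfold p; field; lra.
- intros t Ht.
  assert (Hp := mass_pos (s t) (w t)).
  assert (Hg := gap_le_mass (s t) (w t)).
  assert (HS := Hr t ltac:(lra)).
  set (p := mass (s t) (w t)) in *; set (g := gap (s t) (w t)) in *.
  assert (HgB : g * B t <= p * Rabs (B t)).
  { assert (H0 := Rle_abs (g * B t)); rewrite Rabs_mult in H0.
    assert (Rabs g <= p) by (apply Rabs_le; lra).
    assert (Rabs g * Rabs (B t) <= p * Rabs (B t))
      by (apply Rmult_le_compat_r; [apply Rabs_pos|assumption]); lra. }
  assert (p * (2 + S t + Rabs (B t) / 2) <= 0) by nra.
  nra.
Qed.

(** * Excluding humps at arbitrarily large radii *)

Definition late_humps (s w S B : R -> R) : Prop :=
  forall R0, exists z q, R0 < z /\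
    (hump s w S B z q \/ hump s (fun r => - w r) S (fun r => - B r) z q).

(** Were [S q <= 0], the preceding lemmas would apply in turn: [mass] stays below 1/2, [S] is
    bounded yet drops below -2, [B] becomes small, [r^2 mass] becomes small, and a late hump is
    absurd. *)
Lemma critical_S_pos (s w S B : R -> R) (q : R) :
  flow s w S B -> late_humps s w S B -> 0 < q -> B q = 0 ->
  mass (s q) (w q) <= 1 / 2 -> 0 < S q.
Proof.
intros H Hlate Hq HBq Hmq.
apply Rnot_le_lt; intros HSq.
destruct (right_of_critical_point s w S B q H Hq HBq Hmq HSq) as [a [Hqa [Hma [HSa HFa]]]].
assert (Hafter := fun r Har => mass_stays_small s w S B a r H Har Hma HSa HFa).
set (k := 1 - 4 * gap_energy s w B a) in *.
assert (Hk : 0 < k) by (unfold k; lra).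
destruct (S_bounded_below s w S B a k H) as [M HM]; [lra|exact Hk| |].
{ intros r Hr; destruct (Hafter r) as [H1 H2]; [lra|]; split; lra. }
assert (Hbd : forall r, a <= r -> - M <= S r /\ k <= 1 - 2 * mass (s r) (w r)).
{ intros r Hr; split; [apply HM, Hr|apply Hafter; lra]. }
destruct (S_below_minus_two s w S B a k M H ltac:(lra) Hk Hbd) as [b [Hab HSb]].
(* From [b] on [2 + S <= - eps]; allowing [|B| <= eps] leaves the decay rate [eps / 2]. *)
set (eps := - 2 - S b).
assert (Heps : 0 < eps) by (unfold eps; lra).
destruct (B_small_before_zero s w S B b M eps H ltac:(lra) Heps) as [c [Hbc HBc]].
{ intros r Hr; destruct (Hbd r ltac:(lra)); lra. }
assert (Hdecay : forall r, c <= r ->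
  mass (s r) (w r) <= 1 / 2 /\ 2 + S r + Rabs (B r) / 2 <= - (eps / 2)).
{ intros r Hr; destruct (Hbd r ltac:(lra)) as [_ Hm].
  split; [lra|].
  assert (HSr : S r <= S b).
  { destruct (Req_dec b r) as [->|]; [lra|left].
    apply (flow_S_decreasing s w S B); [exact H|lra|].
    intros t Ht; destruct (Hbd t ltac:(lra)); lra. }
  (* A later hump supplies the zero of [B] beyond [r] that the smallness of [B r] depends on. *)
  destruct (Hlate r) as [z [q' [Hz Hh]]].
  assert (HBr : Rabs (B r) <= eps).
  { destruct Hh as [[Hzq [_ [_ [_ [HB0 _]]]]]|[Hzq [_ [_ [_ [HB0 _]]]]]];
      apply (HBc r q'); lra. }
  unfold eps in *; lra. }
destruct (sqr_mass_small s w S B a k M ((eps / 2) ^ 2 / 3) c H ltac:(lra) Hk)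
  as [d [Hcd [_ Hd]]].
{ apply Rdiv_lt_0_compat; [apply pow_lt|]; lra. }
{ exact Hbd. }
destruct (Hlate d) as [z [q' [Hz Hh]]].
assert (Hzd : 3 * (z ^ 2 * mass (s z) (w z)) < (eps / 2) ^ 2).
{ assert (z ^ 2 * mass (s z) (w z) <= d ^ 2 * mass (s d) (w d)); [|lra].
  apply (sqr_mass_nonincreasing s w S B); [exact H|lra|].
  intros r Hr; destruct (Hdecay r ltac:(lra)); lra. }
destruct Hh as [Hh|Hh].
- apply (decaying_hump_absurd s w S B (eps / 2) z q' H Hh); [lra| |exact Hzd].
  intros r Hr; apply Hdecay; lra.
- apply (decaying_hump_absurd _ _ _ _ (eps / 2) z q' (flow_opp _ _ _ _ H) Hh);
    [lra| |rewrite mass_opp; exact Hzd].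
  intros r Hr; rewrite mass_opp, Rabs_Ropp; apply Hdecay; lra.
Qed.

(** The entry is the last passage of [mass] through 1/2 before a late peak. If [mass] never exceeded
    1/2 beyond [R0], [S] would be positive there and yet decrease with slope bounded away from 0. *)
Lemma late_entry (s w S B : R -> R) (R0 : R) :
  flow s w S B -> late_humps s w S B -> 1 <= R0 ->
  exists e z q, R0 <= e < q /\
    (hump s w S B z q \/ hump s (fun r => - w r) S (fun r => - B r) z q) /\
    (forall r, e <= r <= q -> mass (s r) (w r) <= 1 / 2) /\
    mass (s e) (w e) = 1 / 2 /\ 0 < S q.
Proof.
intros H Hlate HR0.
assert (Hcrit : forall z q, 0 < z ->
  (hump s w S B z q \/ hump s (fun r => - w r) S (fun r => - B r) z q) ->
  z < q /\ B q = 0 /\ mass (s q) (w q) <= 1 / 2 /\ 0 < S q).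
{ intros z q Hz Hh.
  assert (K : z < q /\ B q = 0 /\ mass (s q) (w q) <= 1 / 2).
  { destruct Hh as [[Hzq [_ [_ [_ [HB0 Hm]]]]]|[Hzq [_ [_ [_ [HB0 Hm]]]]]];
      [|rewrite mass_opp in Hm]; repeat split; lra. }
  destruct K as [Hzq [HBq Hm]].
  repeat split; try assumption.
  apply (critical_S_pos s w S B q H Hlate); [lra|exact HBq|exact Hm]. }
destruct (classic (exists r, R0 < r /\ 1 / 2 < mass (s r) (w r))) as [[r [Hr Hmr]]|Hno].
- destruct (Hlate r) as [z [q [Hz Hh]]].
  destruct (Hcrit z q ltac:(lra) Hh) as [Hzq [HBq [Hmq HSq]]].
  (* Stepping back to some [b < q] ensures [e < q]. If [mass = 1/2] at [q], its derivative there is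
     [S q / (2 q) > 0], so it is smaller just before. *)
  assert (Hb : exists b, r < b < q /\ forall t, b <= t <= q -> mass (s t) (w t) <= 1 / 2).
  { destruct (Rle_lt_or_eq_dec _ _ Hmq) as [Hlt|Heq].
    - destruct (continuous_lt (fun r => mass (s r) (w r)) q (1 / 2)) as [d [Hd0 Hd]];
        [apply (flow_continuous_mass s w S B); [exact H|lra]|exact Hlt|].
      exists (Rmax (q - d / 2) ((r + q) / 2)); split.
      + assert (H1 := Rmax_r (q - d / 2) ((r + q) / 2)).
        split; [lra|apply Rmax_lub_lt; lra].
      + intros t Ht; left; apply Hd.
        assert (H1 := Rmax_l (q - d / 2) ((r + q) / 2)).
        apply Rabs_def1; lra.
    - assert (HD := flow_derive_mass s w S B q H ltac:(lra)).
      destruct (is_derive_pos_strict _ _ _ HD) as [d [Hd0 [_ Hd]]].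
      { rewrite Heq, HBq; apply Rdiv_lt_0_compat; lra. }
      exists (Rmax (q - d / 2) ((r + q) / 2)); split.
      + assert (H1 := Rmax_r (q - d / 2) ((r + q) / 2)).
        split; [lra|apply Rmax_lub_lt; lra].
      + intros t Ht.
        assert (H1 := Rmax_l (q - d / 2) ((r + q) / 2)).
        destruct (Req_dec t q) as [->|]; [lra|].
        assert (K := Hd t ltac:(lra)); simpl in K; lra. }
  destruct Hb as [b [Hb Hmb]].
  destruct (last_crossing (fun r => mass (s r) (w r)) r b (1 / 2)) as [e [He [Hme Het]]].
  + lra.
  + intros t Ht; apply (flow_continuous_mass s w S B); [exact H|lra].
  + exact Hmr.
  + apply Hmb; lra.
  + exists e, z, q; split; [lra|split; [exact Hh|split; [|split; [exact Hme|exact HSq]]]].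
    intros t Ht; destruct (Rle_lt_dec t b); [apply Het|apply Hmb]; lra.
- exfalso.
  assert (Hm : forall r, R0 < r -> mass (s r) (w r) <= 1 / 2).
  { intros r Hr; apply Rnot_lt_le; intros Hlt; apply Hno; exists r; split; assumption. }
  assert (HS : forall r, R0 < r -> 0 < S r).
  { intros r Hr; destruct (Hlate r) as [z [q [Hz Hh]]].
    destruct (Hcrit z q ltac:(lra) Hh) as [Hzq [_ [_ HSq]]].
    apply Rlt_trans with (S q); [exact HSq|].
    apply (flow_S_decreasing s w S B); [exact H|lra|].
    intros t Ht; apply Hm; lra. }
  set (a := R0 + 1); set (c := exp (2 * s a)).
  assert (Hc : 0 < c) by apply exp_pos.
  assert (HSa : 0 < S a) by (apply HS; unfold a; lra).
  assert (HSc : 0 < S a / c) by (apply Rdiv_lt_0_compat; assumption).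
  (* [S] falls at rate at least [3 c], so over the length [S a / c] it loses [3 S a] and turns
     negative. *)
  set (b := a + S a / c).
  assert (K : S b + 3 * c * (b - a) <= S a + 3 * c * (a - a)).
  { apply (ge_of_derive_nonpos (fun r => S r + 3 * c * (r - a))
      (fun r => - (r * force (s r) (w r) / 2) + 3 * c)); [unfold b; lra| |].
    - intros t Ht; unfold a, b in Ht; flow_derive H t; field.
    - intros t Ht; unfold a, b in Ht.
      assert (Hs : s a <= s t).
      { apply (flow_s_nondecreasing s w S B); [exact H|unfold a; lra|].
        intros x Hx; left; apply HS; unfold a in Hx; lra. }
      assert (He : c <= exp (2 * s t)).
      { unfold c; destruct Hs as [Hs|Hs]; [left; apply exp_increasing; lra|rewrite Hs; lra]. }
      assert (Hp := mass_pos (s t) (w t)).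
      assert (Hmt := Hm t ltac:(lra)).
      assert (Hf : 6 * c <= force (s t) (w t)) by (unfold force; nra).
      nra. }
  assert (HSb : 0 < S b) by (apply HS; unfold b, a in *; lra).
  replace (3 * c * (b - a)) with (3 * S a) in K by (unfold b; field; lra).
  lra.
Qed.

(** Entry points with [mass = 1/2] occur arbitrarily late, which keeps [energy] at least 1/4 by
    monotonicity, while each passage from an entry to its peak costs 1/30000. *)
Lemma no_late_humps (s w S B : R -> R) : flow s w S B -> ~ late_humps s w S B.
Proof.
intros H Hlate.
assert (Hlow : forall r, 1 <= r -> 1 / 4 <= energy s w S B r).
{ intros r Hr.
  destruct (late_entry s w S B r H Hlate Hr) as [e [z [q [He [_ [_ [Hme _]]]]]]].
  apply Rle_trans with (energy s w S B e);
    [|apply flow_energy_nonincreasing; [exact H|lra]].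
  unfold energy; rewrite Hme.
  assert (Hexp := exp_pos (2 * s e)).
  assert (0 <= (S e ^ 2 + B e ^ 2 / 12) / e ^ 2); [|lra].
  apply Rdiv_le_0_compat; [nra|apply pow_lt; lra]. }
assert (Hdrop : forall n : nat, exists r, 1 <= r /\
  energy s w S B r <= energy s w S B 1 - INR n / 30000).
{ induction n as [|n [r [Hr IH]]].
  - exists 1; simpl; lra.
  - destruct (late_entry s w S B r H Hlate Hr) as [e [z [q [He [Hh [Hm [Hme HSq]]]]]]].
    exists q; split; [lra|].
    assert (Her : energy s w S B e <= energy s w S B r)
      by (apply flow_energy_nonincreasing; [exact H|lra]).
    (* [late_entry] does not place [z] beyond 1; when [z < 1], [energy] at [z] is at least its value
       at 1. *)
    assert (Hez : 1 / 4 <= energy s w S B z).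
    { destruct (Rle_lt_dec 1 z) as [Hz|Hz]; [apply Hlow, Hz|].
      apply Rle_trans with (energy s w S B 1); [apply Hlow; lra|].
      apply flow_energy_nonincreasing; [exact H|].
      split; [destruct Hh as [Hh|Hh]; apply Hh|lra]. }
    assert (Hqe : energy s w S B q <= energy s w S B e - 1 / 30000).
    { destruct Hh as [Hh|Hh].
      - apply (hump_energy_drop s w S B e z q); try assumption; lra.
      - assert (K := hump_energy_drop _ _ _ _ e z q (flow_opp _ _ _ _ H) Hh).
        rewrite !energy_opp in K; apply K; [lra| | |lra|exact Hez].
        + intros t Ht; rewrite mass_opp; apply Hm, Ht.
        + rewrite mass_opp; exact Hme. }
    rewrite S_INR; lra. }
destruct (INR_unbounded (30000 * energy s w S B 1)) as [n Hn].
destruct (Hdrop n) as [r [Hr Hle]].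
specialize (Hlow r Hr); lra.
Qed.

(** * Zeros of the difference *)

Lemma flow_continuous_w (s w S B : R -> R) (r : R) :
  flow s w S B -> 0 < r -> continuous w r.
Proof.
intros H Hr; apply (ex_derive_continuous w); exists (B r / r); apply (H r Hr).
Qed.

(** Unique continuation: [|gap| <= mass |w|] lets the equations for [w] and [B] be treated as linear
    with bounded coefficients on [[a, b]], and Gronwall applies to [w^2 + B^2]. *)
Lemma flow_zero_propagates (s w S B : R -> R) (a b : R) :
  flow s w S B -> 0 < a <= b -> (w a = 0 /\ B a = 0 <-> w b = 0 /\ B b = 0).
Proof.
intros H Hab.
destruct (continuity_ab_maj (fun r => mass (s r) (w r)) a b) as [m [Hm _]].
{ lra. }
{ intros c Hc; apply continuity_pt_filterlim.
  apply (flow_continuous_mass s w S B); [exact H|lra]. }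
set (L := mass (s m) (w m)) in *.
assert (HL : 0 < L) by apply mass_pos.
assert (K : w a ^ 2 + B a ^ 2 = 0 <-> w b ^ 2 + B b ^ 2 = 0).
{ apply (nonneg_zero_of_derive_bound (fun r => w r ^ 2 + B r ^ 2)
    (fun r => 2 * w r * B r / r
       - 6 * r * B r * gap (s r) (w r) * (1 - 2 * mass (s r) (w r)))
    (1 / a + 3 * b * L * (1 + 2 * L))); [lra| | |].
  - intros r Hr; flow_derive H r; field; lra.
  - intros r Hr; nra.
  - intros r Hr.
    assert (Hp := mass_pos (s r) (w r)).
    assert (HpL := Hm r Hr); simpl in HpL.
    assert (Hg := abs_gap_le (s r) (w r)).
    set (x := Rabs (w r)) in *; set (y := Rabs (B r)).
    assert (Hx : 0 <= x) by apply Rabs_pos.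
    assert (Hy : 0 <= y) by apply Rabs_pos.
    assert (Hx2 : w r ^ 2 = x ^ 2) by (unfold x; rewrite pow2_abs; reflexivity).
    assert (Hy2 : B r ^ 2 = y ^ 2) by (unfold y; rewrite pow2_abs; reflexivity).
    rewrite Hx2, Hy2.
    assert (H1 : Rabs (2 * w r * B r / r) <= 1 / a * (x ^ 2 + y ^ 2)).
    { unfold Rdiv; rewrite !Rabs_mult, (Rabs_right 2), (Rabs_right (/ r)) by
        (first [lra | left; apply Rinv_0_lt_compat; lra]).
      fold x y.
      assert (/ r <= / a) by (apply Rinv_le_contravar; lra).
      assert (0 < / r) by (apply Rinv_0_lt_compat; lra).
      assert (0 <= x * y) by (apply Rmult_le_pos; assumption).
      apply Rle_trans with (2 * x * y * / a); [apply Rmult_le_compat_l; lra|].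
      assert (0 <= (x - y) ^ 2) by apply pow2_ge_0.
      assert (2 * x * y * / a <= (x ^ 2 + y ^ 2) * / a)
        by (apply Rmult_le_compat_r; lra).
      lra. }
    assert (H2 : Rabs (6 * r * B r * gap (s r) (w r) * (1 - 2 * mass (s r) (w r)))
                 <= 3 * b * L * (1 + 2 * L) * (x ^ 2 + y ^ 2)).
    { rewrite !Rabs_mult, (Rabs_right 6), (Rabs_right r) by lra; fold y.
      assert (Hm1 : Rabs (1 - 2 * mass (s r) (w r)) <= 1 + 2 * L) by (apply Rabs_le; lra).
      assert (Hg' : Rabs (gap (s r) (w r)) <= L * x).
      { apply Rle_trans with (1 := Hg); apply Rmult_le_compat_r; lra. }
      assert (H0 := Rabs_pos (gap (s r) (w r))).
      assert (H0' := Rabs_pos (1 - 2 * mass (s r) (w r))).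
      apply Rle_trans with (6 * b * y * (L * x) * (1 + 2 * L)).
      - repeat apply Rmult_le_compat; try lra; repeat apply Rmult_le_pos; lra.
      - assert (0 <= (x - y) ^ 2) by apply pow2_ge_0.
        assert (0 <= 3 * b * L * (1 + 2 * L)) by (repeat apply Rmult_le_pos; lra).
        assert (3 * b * L * (1 + 2 * L) * (2 * x * y) <= 3 * b * L * (1 + 2 * L) * (x ^ 2 + y ^ 2))
          by (apply Rmult_le_compat_l; lra).
        lra. }
    apply Rle_trans with (1 := Rabs_triang _ _).
    rewrite Rabs_Ropp; lra. }
assert (Hsq : forall x y : R, x ^ 2 + y ^ 2 = 0 <-> x = 0 /\ y = 0).
{ intros x y; split.
  - intros E; split; nra.
  - intros [-> ->]; ring. }
rewrite <- !Hsq; exact K.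
Qed.

Lemma flow_zeros_simple (s w S B : R -> R) (z : R) :
  flow s w S B -> (exists r, 0 < r /\ w r <> 0) -> 0 < z -> w z = 0 -> B z <> 0.
Proof.
intros H [r [Hr Hwr]] Hz Hwz HBz; apply Hwr.
destruct (Rle_lt_dec z r) as [Hle|Hlt].
- apply (flow_zero_propagates s w S B z r H); [lra|split; assumption].
- apply (flow_zero_propagates s w S B r z H); [lra|split; assumption].
Qed.

(** Take [q] a maximum of [w] on [[a, b]] and [z] the last zero before it. If [mass > 1/2] at [q],
    [B] would increase there and [w] would grow beyond its maximum. *)
Lemma hump_of_zeros (s w S B : R -> R) (a b : R) :
  flow s w S B -> (exists r, 0 < r /\ w r <> 0) -> 0 < a < b ->
  w a = 0 -> w b = 0 -> 0 < B a -> exists z q, a <= z /\ hump s w S B z q.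
Proof.
intros H Hne Hab Hwa Hwb HBa.
assert (Hw' : forall r, 0 < r -> is_derive w r (B r / r)) by (intros r Hr; apply (H r Hr)).
destruct (continuity_ab_maj w a b) as [q [Hmax Hq]].
{ lra. }
{ intros c Hc; apply continuity_pt_filterlim.
  apply (flow_continuous_w s w S B); [exact H|lra]. }
assert (Hwq : 0 < w q).
{ destruct (is_derive_pos_strict _ _ _ (Hw' a ltac:(lra))) as [d [Hd0 [Hd _]]].
  { apply Rdiv_lt_0_compat; lra. }
  set (r := Rmin b (a + d / 2)).
  assert (Hr : a < r <= b /\ r <= a + d / 2).
  { unfold r; split; [split|]; [apply Rmin_glb_lt; lra|apply Rmin_l|apply Rmin_r]. }
  assert (K := Hd r ltac:(lra)); assert (K' := Hmax r ltac:(lra)); lra. }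
assert (Hqa : a < q < b).
{ split; apply Rnot_le_lt; intros Hle.
  - replace q with a in Hwq by lra; lra.
  - replace q with b in Hwq by lra; lra. }
assert (Hright : forall d, 0 < d -> exists r, q < r < b /\ r < q + d).
{ intros d Hd; exists (Rmin ((q + b) / 2) (q + d / 2)).
  assert (H1 := Rmin_l ((q + b) / 2) (q + d / 2)).
  assert (H2 := Rmin_r ((q + b) / 2) (q + d / 2)).
  assert (q < Rmin ((q + b) / 2) (q + d / 2)) by (apply Rmin_glb_lt; lra); lra. }
assert (HBq : B q = 0).
{ destruct (Rtotal_order (B q) 0) as [Hlt|[Heq|Hgt]]; [|exact Heq|].
  - destruct (is_derive_neg_strict _ _ _ (Hw' q ltac:(lra))) as [d [Hd0 [_ Hd]]].
    { apply Rdiv_neg_pos; lra. }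
    set (r := Rmax a (q - d / 2)).
    assert (Hr : a <= r < q /\ q - d / 2 <= r).
    { unfold r; split; [split|]; [apply Rmax_l|apply Rmax_lub_lt; lra|apply Rmax_r]. }
    assert (K := Hd r ltac:(lra)); assert (K' := Hmax r ltac:(lra)); lra.
  - destruct (is_derive_pos_strict _ _ _ (Hw' q ltac:(lra))) as [d [Hd0 [Hd _]]].
    { apply Rdiv_lt_0_compat; lra. }
    destruct (Hright d Hd0) as [r Hr].
    assert (K := Hd r ltac:(lra)); assert (K' := Hmax r ltac:(lra)); lra. }
assert (Hmq : mass (s q) (w q) <= 1 / 2).
{ apply Rnot_lt_le; intros Hlt.
  assert (Hg := gap_pos (s q) (w q) Hwq).
  assert (HB' : is_derive B q (- (3 * q * gap (s q) (w q) * (1 - 2 * mass (s q) (w q)))))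
    by (apply H; lra).
  destruct (is_derive_pos_strict _ _ _ HB') as [d [Hd0 [Hd _]]].
  { assert (0 < 3 * q * gap (s q) (w q) * (2 * mass (s q) (w q) - 1)); [|lra].
    repeat apply Rmult_lt_0_compat; lra. }
  destruct (Hright d Hd0) as [r Hr].
  assert (K : - w r < - w q).
  { apply (gt_of_derive_neg (fun t => - w t) (fun t => - (B t / t))); [lra| |].
    - intros t Ht; apply (is_derive_opp w); apply Hw'; lra.
    - intros t Ht; assert (K := Hd t ltac:(lra)).
      assert (0 < B t / t) by (apply Rdiv_lt_0_compat; lra); lra. }
  assert (K' := Hmax r ltac:(lra)); lra. }
destruct (last_nonpos w a q) as [z [Hz [Hwz Hpos]]]; [lra| |lra|exact Hwq|].
{ intros r Hr; apply (flow_continuous_w s w S B); [exact H|lra]. }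
exists z, q; split; [lra|].
split; [lra|split; [exact Hwz|split; [exact Hpos|split; [|split; assumption]]]].
assert (HBz := flow_zeros_simple s w S B z H Hne ltac:(lra) Hwz).
apply Rnot_le_lt; intros Hle.
destruct (is_derive_neg_strict _ _ _ (Hw' z ltac:(lra))) as [d [Hd0 [Hd _]]].
{ apply Rdiv_neg_pos; lra. }
set (r := Rmin q (z + d / 2)).
assert (Hr : z < r <= q /\ r <= z + d / 2).
{ unfold r; split; [split|]; [apply Rmin_glb_lt; lra|apply Rmin_l|apply Rmin_r]. }
assert (K := Hd r ltac:(lra)); assert (K' := Hpos r ltac:(lra)); lra.
Qed.

(** Two zeros beyond any given radius yield a hump; the sign of [B] at the first decides between [w]
    and [- w]. *)
Lemma flow_zeros_bounded (s w S B : R -> R) :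
  flow s w S B -> (exists r, 0 < r /\ w r <> 0) ->
  exists R0, forall r, R0 < r -> w r <> 0.
Proof.
intros H Hne; apply NNPP; intros Hno.
assert (Hz : forall R0, exists r, R0 < r /\ w r = 0).
{ intros R0; apply NNPP; intros Hn; apply Hno; exists R0; intros r Hr Hw.
  apply Hn; exists r; split; assumption. }
apply (no_late_humps s w S B H); intros R0.
destruct (Hz (Rmax 0 R0)) as [a [Ha Hwa]].
assert (H1 := Rmax_l 0 R0); assert (H2 := Rmax_r 0 R0).
destruct (Hz a) as [b [Hb Hwb]].
assert (HBa := flow_zeros_simple s w S B a H Hne ltac:(lra) Hwa).
destruct (Rle_lt_dec 0 (B a)) as [Hle|Hlt].
- destruct (hump_of_zeros s w S B a b H Hne) as [z [q [Hz' Hh]]]; try lra.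
  exists z, q; split; [lra|left; exact Hh].
- destruct (hump_of_zeros _ _ _ _ a b (flow_opp _ _ _ _ H)) as [z [q [Hz' Hh]]]; try lra.
  { destruct Hne as [r [Hr Hw]]; exists r; split; [exact Hr|lra]. }
  exists z, q; split; [lra|right; exact Hh].
Qed.

Lemma flow_zeros_isolated (s w S B : R -> R) (r : R) :
  flow s w S B -> (exists r, 0 < r /\ w r <> 0) -> 0 < r ->
  exists d, 0 < d /\ forall t, Rabs (t - r) < d -> w t = 0 -> t = r.
Proof.
intros H Hne Hr.
destruct (Req_dec (w r) 0) as [Hw|Hw].
- assert (HB := flow_zeros_simple s w S B r H Hne Hr Hw).
  assert (Hw' : is_derive w r (B r / r)) by apply (H r Hr).
  assert (K : exists d, 0 < d /\ forall t, Rabs (t - r) < d -> t <> r -> w t <> 0).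
  { destruct (Rle_lt_dec 0 (B r)) as [Hle|Hlt].
    - destruct (is_derive_pos_strict _ _ _ Hw') as [d [Hd0 [Hd1 Hd2]]].
      { apply Rdiv_lt_0_compat; lra. }
      exists d; split; [exact Hd0|intros t Ht Hne'; apply Rabs_def2 in Ht].
      destruct (Rlt_le_dec r t); [specialize (Hd1 t)|specialize (Hd2 t)]; lra.
    - destruct (is_derive_neg_strict _ _ _ Hw') as [d [Hd0 [Hd1 Hd2]]].
      { apply Rdiv_neg_pos; lra. }
      exists d; split; [exact Hd0|intros t Ht Hne'; apply Rabs_def2 in Ht].
      destruct (Rlt_le_dec r t); [specialize (Hd1 t)|specialize (Hd2 t)]; lra. }
  destruct K as [d [Hd0 Hd]].
  exists d; split; [exact Hd0|intros t Ht Hwt].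
  apply NNPP; intros Htr; exact (Hd t Ht Htr Hwt).
- assert (Hc := flow_continuous_w s w S B r H Hr).
  destruct (Rlt_le_dec 0 (w r)) as [Hlt|Hle].
  + destruct (continuous_gt w r 0 Hc Hlt) as [d [Hd0 Hd]].
    exists d; split; [exact Hd0|intros t Ht Hwt; specialize (Hd t Ht); lra].
  + destruct (continuous_lt w r 0 Hc) as [d [Hd0 Hd]]; [lra|].
    exists d; split; [exact Hd0|intros t Ht Hwt; specialize (Hd t Ht); lra].
Qed.

(** Contraction: if [|w| <= W] on [(0, z]] and [w z = 0], integrating the equation for [B] from 0
    and then [w' = B / r] back from [z] gives [|w| <= W / 2]. Iterating leaves only 0. *)
Lemma flow_zero_near_origin (s w S B : R -> R) (C d : R) :
  flow s w S B -> 0 < d ->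
  (forall r, 0 < r < d -> Rabs (w r) <= C /\ mass (s r) (w r) <= C) ->
  filterlim B (at_right 0) (locally 0) ->
  exists delta, 0 < delta /\
    forall z, 0 < z < delta -> w z = 0 -> forall r, 0 < r <= z -> w r = 0.
Proof.
intros H Hd Hbd HB.
assert (HC : 0 < C).
{ destruct (Hbd (d / 2)) as [_ K]; [lra|].
  assert (K' := mass_pos (s (d / 2)) (w (d / 2))); lra. }
set (K := 3 * C * (1 + 2 * C)).
assert (HK : 0 < K) by (unfold K; repeat apply Rmult_lt_0_compat; lra).
assert (HKinv : 0 < / (1 + K)) by (apply Rinv_0_lt_compat; lra).
(* [z (1 + K) < 1] gives [K z^2 <= 2], hence the contraction factor 1/2. *)
exists (Rmin d (/ (1 + K))); split; [apply Rmin_glb_lt; assumption|].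
intros z [Hz0 Hz] Hwz.
assert (Hzd : z < d) by (apply Rlt_le_trans with (1 := Hz), Rmin_l).
assert (HzK : z < / (1 + K)) by (apply Rlt_le_trans with (1 := Hz), Rmin_r).
assert (HzK' : z * (1 + K) < 1).
{ apply (Rmult_lt_compat_r (1 + K)) in HzK; [|lra]. rewrite Rinv_l in HzK; lra. }
assert (HKz : K * z ^ 2 <= 2) by nra.
assert (HB' : forall W r, 0 <= W -> (forall t, 0 < t <= z -> Rabs (w t) <= W) ->
  0 < r <= z -> Rabs (- (3 * r * gap (s r) (w r) * (1 - 2 * mass (s r) (w r)))) <= K * W * r).
{ intros W r HW HwW Hr.
  destruct (Hbd r ltac:(lra)) as [_ Hm].
  assert (Hp := mass_pos (s r) (w r)).
  rewrite Rabs_Ropp, !Rabs_mult, (Rabs_right 3), (Rabs_right r) by lra.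
  assert (Hg : Rabs (gap (s r) (w r)) <= C * W).
  { apply Rle_trans with (1 := abs_gap_le _ _).
    apply Rmult_le_compat; [lra|apply Rabs_pos|exact Hm|apply HwW, Hr]. }
  assert (H1 : Rabs (1 - 2 * mass (s r) (w r)) <= 1 + 2 * C) by (apply Rabs_le; lra).
  replace (K * W * r) with (3 * r * (C * W) * (1 + 2 * C)) by (unfold K; ring).
  apply Rmult_le_compat; [|apply Rabs_pos| |exact H1].
  - apply Rmult_le_pos; [lra|apply Rabs_pos].
  - apply Rmult_le_compat_l; [lra|exact Hg]. }
assert (HBle : forall W r, 0 <= W -> (forall t, 0 < t <= z -> Rabs (w t) <= W) ->
  0 < r <= z -> Rabs (B r) <= K * W / 2 * r ^ 2).
{ intros W r HW HwW Hr.
  (* [B] has only a limit at 0, so it is compared with its value at a small [t] where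
     [|B t| < eps]. *)
  apply le_epsilon; intros eps Heps.
  assert (Hloc : locally 0 (fun y => Rabs y < eps)).
  { exists (mkposreal eps Heps); intros y Hy.
    change (Rabs (y - 0) < eps) in Hy; rewrite Rminus_0_r in Hy; exact Hy. }
  destruct (HB _ Hloc) as [d1 Hd1].
  assert (Hd1p := cond_pos d1).
  set (t := Rmin (r / 2) (d1 / 2)).
  assert (Ht : 0 < t <= r /\ t <= d1 / 2).
  { unfold t; assert (H1 := Rmin_l (r / 2) (d1 / 2)); assert (H2 := Rmin_r (r / 2) (d1 / 2)).
    assert (0 < Rmin (r / 2) (d1 / 2)) by (apply Rmin_glb_lt; lra); lra. }
  assert (HBt : Rabs (B t) < eps).
  { apply Hd1; [|lra].
    change (Rabs (t - 0) < d1); rewrite Rminus_0_r, Rabs_right; lra. }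
  assert (Hbnd : forall x, t < x < r ->
    - (K * W * x) <= - (3 * x * gap (s x) (w x) * (1 - 2 * mass (s x) (w x))) <= K * W * x).
  { intros x Hx; apply Rabs_le_between, HB'; [exact HW|exact HwW|lra]. }
  assert (H1 : B r - K * W / 2 * r ^ 2 <= B t - K * W / 2 * t ^ 2).
  { apply (ge_of_derive_nonpos (fun r => B r - K * W / 2 * r ^ 2)
      (fun r => - (3 * r * gap (s r) (w r) * (1 - 2 * mass (s r) (w r))) - K * W * r)); [lra| |].
    - intros x Hx; flow_derive H x; field.
    - intros x Hx; destruct (Hbnd x Hx); lra. }
  assert (H2 : B t + K * W / 2 * t ^ 2 <= B r + K * W / 2 * r ^ 2).
  { apply (le_of_derive_nonneg (fun r => B r + K * W / 2 * r ^ 2)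
      (fun r => - (3 * r * gap (s r) (w r) * (1 - 2 * mass (s r) (w r))) + K * W * r)); [lra| |].
    - intros x Hx; flow_derive H x; field.
    - intros x Hx; destruct (Hbnd x Hx); lra. }
  assert (0 <= K * W / 2 * t ^ 2).
  { apply Rmult_le_pos; [apply Rmult_le_pos; [apply Rmult_le_pos|]|apply pow2_ge_0]; lra. }
  apply Rabs_def2 in HBt; apply Rabs_le; lra. }
assert (Hhalf : forall W, 0 <= W -> (forall t, 0 < t <= z -> Rabs (w t) <= W) ->
  forall r, 0 < r <= z -> Rabs (w r) <= W / 2).
{ intros W HW HwW r Hr.
  assert (Hbnd : forall x, r < x < z -> - (K * W / 2 * x) <= B x / x <= K * W / 2 * x).
  { intros x Hx; apply Rabs_le_between.
    unfold Rdiv at 1; rewrite Rabs_mult, (Rabs_right (/ x)) by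
      (left; apply Rinv_0_lt_compat; lra).
    assert (K1 := HBle W x HW HwW ltac:(lra)).
    apply (Rle_div_l (Rabs (B x))); [lra|]. lra. }
  assert (H1 : w z - K * W / 4 * z ^ 2 <= w r - K * W / 4 * r ^ 2).
  { apply (ge_of_derive_nonpos (fun r => w r - K * W / 4 * r ^ 2)
      (fun r => B r / r - K * W / 2 * r)); [lra| |].
    - intros x Hx; flow_derive H x; field; lra.
    - intros x Hx; destruct (Hbnd x Hx); lra. }
  assert (H2 : w r + K * W / 4 * r ^ 2 <= w z + K * W / 4 * z ^ 2).
  { apply (le_of_derive_nonneg (fun r => w r + K * W / 4 * r ^ 2)
      (fun r => B r / r + K * W / 2 * r)); [lra| |].
    - intros x Hx; flow_derive H x; field; lra.
    - intros x Hx; destruct (Hbnd x Hx); lra. }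
  assert (0 <= K * W / 4 * r ^ 2).
  { apply Rmult_le_pos; [apply Rmult_le_pos; [apply Rmult_le_pos|]|apply pow2_ge_0]; lra. }
  assert (K * W / 4 * z ^ 2 <= W / 2) by nra.
  apply Rabs_le; lra. }
assert (Hn : forall n r, 0 < r <= z -> Rabs (w r) <= C * (1 / 2) ^ n).
{ induction n as [|n IH]; intros r Hr.
  - simpl; rewrite Rmult_1_r; apply Hbd; lra.
  - replace (C * (1 / 2) ^ Datatypes.S n) with (C * (1 / 2) ^ n / 2) by (simpl; field).
    apply Hhalf; [|exact IH|exact Hr].
    apply Rmult_le_pos; [lra|apply pow_le; lra]. }
intros r Hr; apply NNPP; intros Hw.
apply Rabs_pos_lt in Hw.
destruct (pow_lt_1_zero (1 / 2)) with (y := Rabs (w r) / C) as [n Hlt].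
{ rewrite Rabs_right; lra. }
{ apply Rdiv_lt_0_compat; assumption. }
specialize (Hlt n (Nat.le_refl n)); specialize (Hn n r Hr).
rewrite Rabs_right in Hlt by (apply Rle_ge, pow_le; lra).
apply (Rmult_lt_compat_l C) in Hlt; [|exact HC].
replace (C * (Rabs (w r) / C)) with (Rabs (w r)) in Hlt by (field; lra).
lra.
Qed.

(** * Reduction of the original system to the flow, and behaviour at the origin *)

Lemma flow_of_entire_radial_solution (N1 N2 : R) (u v : R -> R) :
  entire_radial_solution N1 N2 u v ->
  flow (fun r => (u r + v r) / 2) (fun r => u r - v r)
    (fun r => r * Derive u r / 2 + r * Derive v r / 2)
    (fun r => r * Derive u r - r * Derive v r).
Proof.
intros [Hu [Hv [Eu [Ev _]]]] r Hr.
destruct (Hu r Hr) as [Hu1 Hu2]; destruct (Hv r Hr) as [Hv1 Hv2].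
assert (Hu3 := Derive_correct _ _ Hu1); assert (Hv3 := Derive_correct _ _ Hv1).
assert (Hu4 := Derive_correct _ _ Hu2); assert (Hv4 := Derive_correct _ _ Hv2).
specialize (Eu r Hr); specialize (Ev r Hr); unfold radial_laplacian in Eu, Ev.
change (Derive_n u 2 r) with (Derive (Derive u) r) in Eu.
change (Derive_n v 2 r) with (Derive (Derive v) r) in Ev.
assert (Ex : exp ((u r + v r) / 2 + (u r - v r) / 2) = exp (u r)) by (f_equal; field).
assert (Ey : exp ((u r + v r) / 2 - (u r - v r) / 2) = exp (v r)) by (f_equal; field).
assert (Exy : exp (2 * ((u r + v r) / 2)) = exp (u r) * exp (v r)).
{ rewrite <- exp_plus; f_equal; field. }
replace (2 * u r) with (u r + u r) in Eu, Ev by ring.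
replace (2 * v r) with (v r + v r) in Eu, Ev by ring.
rewrite !exp_plus in Eu, Ev.
unfold force, mass, gap; rewrite Ex, Ey, Exy.
set (u2 := Derive (Derive u) r) in *; set (v2 := Derive (Derive v) r) in *.
set (u1 := Derive u) in *; set (v1 := Derive v) in *.
set (x := exp (u r)) in *; set (y := exp (v r)) in *.
(* With [p = x + y], the two right-hand sides add up to [- p (1 - 2 p) - 6 x y], and their
   difference is [- 3 (x - y) (1 - 2 p)]. *)
assert (Du : u2 = - 2 * x + y + 4 * (x * x) - 2 * (y * y) - x * y - / r * u1 r) by lra.
assert (Dv : v2 = x - 2 * y - 2 * (x * x) + 4 * (y * y) - x * y - / r * v1 r) by lra.
split; [|split; [|split]].
- auto_derive; [split; [exact Hu1|split; [exact Hv1|exact I]]|].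
  rewrite_derive Hu3; rewrite_derive Hv3; field; lra.
- auto_derive; [split; [exact Hu1|split; [exact Hv1|exact I]]|].
  rewrite_derive Hu3; rewrite_derive Hv3; field; lra.
- auto_derive; [split; [exact Hu2|split; [exact Hv2|exact I]]|].
  rewrite_derive Hu4; rewrite_derive Hv4; rewrite Du, Dv; field; lra.
- auto_derive; [split; [exact Hu2|split; [exact Hv2|exact I]]|].
  rewrite_derive Hu4; rewrite_derive Hv4; rewrite Du, Dv; field; lra.
Qed.

Lemma dirac_mass_bound (N : R) (u : R -> R) :
  dirac_mass_at_origin N u ->
  exists C d, 0 < d /\ forall r, 0 < r < d -> Rabs (u r - 2 * N * ln r) <= C.
Proof.
intros [[C [d Hd]] _]; exists C, d; split; [apply cond_pos|].
intros r Hr; apply Hd; [|lra].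
change (Rabs (r - 0) < d); rewrite Rminus_0_r, Rabs_right; lra.
Qed.

Lemma zeros_away_from_origin (N1 N2 : R) (u v : R -> R) :
  0 <= N1 -> 0 <= N2 -> entire_radial_solution N1 N2 u v ->
  (exists r, 0 < r /\ u r - v r <> 0) ->
  exists delta, 0 < delta /\ forall r, 0 < r < delta -> u r - v r <> 0.
Proof.
intros hN1 hN2 Huv Hne.
assert (H := flow_of_entire_radial_solution N1 N2 u v Huv).
destruct Huv as [_ [_ [_ [_ [Du Dv]]]]].
destruct (dirac_mass_bound N1 u Du) as [C1 [d1 [Hd1 HC1]]].
destruct (dirac_mass_bound N2 v Dv) as [C2 [d2 [Hd2 HC2]]].
set (d := Rmin 1 (Rmin d1 d2)).
assert (Hd : 0 < d /\ d <= 1 /\ d <= d1 /\ d <= d2).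
{ unfold d; assert (H4 := Rmin_l 1 (Rmin d1 d2)); assert (H5 := Rmin_r 1 (Rmin d1 d2)).
  assert (H6 := Rmin_l d1 d2); assert (H7 := Rmin_r d1 d2).
  split; [|lra]. repeat apply Rmin_glb_lt; lra. }
assert (Hln : forall r, 0 < r < d -> ln r < 0).
{ intros r Hr; rewrite <- ln_1; apply ln_increasing; lra. }
assert (Hbu : forall r, 0 < r < d -> - C1 <= u r - 2 * N1 * ln r <= C1).
{ intros r Hr; apply Rabs_le_between, HC1; lra. }
assert (Hbv : forall r, 0 < r < d -> - C2 <= v r - 2 * N2 * ln r <= C2).
{ intros r Hr; apply Rabs_le_between, HC2; lra. }
destruct (Req_dec N1 N2) as [HN|HN].
(* For equal masses the logarithms cancel in [w]; and [N ln r <= 0] near 0 bounds [u] by [C1] and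
   [v] by [C2], hence [mass]. *)
- set (C := C1 + C2 + exp C1 + exp C2).
  destruct (flow_zero_near_origin _ _ _ _ C d H) as [delta [Hdelta Hzero]].
  + lra.
  + intros r Hr; specialize (Hln r Hr); specialize (Hbu r Hr); specialize (Hbv r Hr).
    assert (E1 := exp_pos C1); assert (E2 := exp_pos C2).
    split.
    * rewrite HN in Hbu; apply Rabs_le; unfold C; lra.
    * unfold mass.
      replace ((u r + v r) / 2 + (u r - v r) / 2) with (u r) by field.
      replace ((u r + v r) / 2 - (u r - v r) / 2) with (v r) by field.
      assert (Hle : forall a b, a <= b -> exp a <= exp b).
      { intros a b [Hab|Hab]; [left; apply exp_increasing, Hab|rewrite Hab; lra]. }
      assert (exp (u r) <= exp C1) by (apply Hle; nra).
      assert (exp (v r) <= exp C2) by (apply Hle; nra).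
      unfold C; lra.
  + replace 0 with (2 * N1 - 2 * N2) at 2 by (rewrite HN; ring).
    apply (filterlim_comp_2 (G := locally (2 * N1)) (H := locally (- (2 * N2)))
      (fun r => r * Derive u r) (fun r => - (r * Derive v r)) Rplus); [apply Du| |].
    * apply (filterlim_comp _ _ _ (fun r => r * Derive v r) Ropp _ (locally (2 * N2)));
        [apply Dv|apply (filterlim_opp (2 * N2))].
    * apply (filterlim_plus (2 * N1) (- (2 * N2))).
  + exists delta; split; [exact Hdelta|intros r Hr Hw].
    assert (Hz := Hzero r Hr Hw).
    (* [w] vanishes on all of [(0, r]]; at the interior point [r / 2] its derivative is therefore 0,
       which a simple zero forbids. *)
    assert (Hsimple := flow_zeros_simple _ _ _ _ (r / 2) H Hne ltac:(lra)).
    apply Hsimple; [apply Hz; lra|].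
    assert (Hw' := proj1 (proj2 (H (r / 2) ltac:(lra)))).
    set (w := fun r => u r - v r) in *.
    assert (E0 : is_derive w (r / 2) 0).
    { apply (is_derive_ext_loc (fun _ => 0)); [|apply @is_derive_const].
      assert (Hr2 : 0 < r / 2) by lra.
      exists (mkposreal _ Hr2); intros t Ht.
      change (Rabs (t - r / 2) < r / 2) in Ht; apply Rabs_def2 in Ht.
      symmetry; apply Hz; lra. }
    assert (E := is_derive_unique _ _ _ Hw').
    rewrite (is_derive_unique _ _ _ E0) in E.
    apply Rmult_eq_reg_r with (/ (r / 2)); [|apply Rinv_neq_0_compat; lra].
    rewrite Rmult_0_l; symmetry; exact E.
- set (k := 2 * (N1 - N2)).
  assert (Hk : 0 < Rabs k) by (apply Rabs_pos_lt; unfold k; lra).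
  (* Within this radius [|k| |ln r| > C1 + C2 + 1], whereas [w r = 0] would bound it by
     [C1 + C2]. *)
  exists (Rmin d (exp (- ((C1 + C2 + 1) / Rabs k)))).
  split; [apply Rmin_glb_lt; [lra|apply exp_pos]|].
  intros r [Hr0 Hr] Hw.
  assert (Hrd : r < d) by (apply Rlt_le_trans with (1 := Hr), Rmin_l).
  assert (Hre : r < exp (- ((C1 + C2 + 1) / Rabs k)))
    by (apply Rlt_le_trans with (1 := Hr), Rmin_r).
  apply ln_increasing in Hre; [|exact Hr0]; rewrite ln_exp in Hre.
  specialize (Hbu r ltac:(lra)); specialize (Hbv r ltac:(lra)).
  assert (Hkl : Rabs (k * ln r) <= C1 + C2) by (apply Rabs_le; unfold k; lra).
  rewrite Rabs_mult, (Rabs_left (ln r)) in Hkl by (apply Hln; lra).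
  assert (Hre' : (C1 + C2 + 1) / Rabs k < - ln r) by lra.
  apply Rlt_div_l in Hre'; [|exact Hk]. lra.
Qed.

Theorem corollary1p7 (N1 N2 : R) (hN1 : 0 <= N1) (hN2 : 0 <= N2)
  (u v : R -> R) (huv : entire_radial_solution N1 N2 u v)
  (hne : exists r : R, 0 < r /\ u r <> v r) :
  Finite_sets.Finite R (fun r : R => 0 < r /\ u r = v r).
Proof.
assert (Hne : exists r, 0 < r /\ u r - v r <> 0).
{ destruct hne as [r [Hr Huv]]; exists r; split; [exact Hr|lra]. }
assert (H := flow_of_entire_radial_solution N1 N2 u v huv).
destruct (zeros_away_from_origin N1 N2 u v hN1 hN2 huv Hne) as [a [Ha Hnear]].
destruct (flow_zeros_bounded _ _ _ _ H Hne) as [b Hfar].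
apply Finite_downward_closed with (fun r => a <= r <= b /\ u r - v r = 0).
- apply (finite_of_isolated (fun r => u r - v r = 0)).
  intros r Hr; apply (flow_zeros_isolated _ _ _ _ r H Hne); lra.
- intros r [Hr Huv]; assert (Hw : u r - v r = 0) by lra.
  split; [|exact Hw].
  split; apply Rnot_lt_le; intros Hlt.
  + apply (Hnear r); [lra|exact Hw].
  + apply (Hfar r); [exact Hlt|exact Hw].
Qed.
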